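(* Consider a sequence of problems indexed by the sample size $n\to\infty$, with dimension $d=d_n$ and clique size $s=s_n\le d_n$. Suppose that the Computational Hardness of Sparse PCA conjecture (stated in the context) holds, and let $\delta>0$ be any fixed small constant. If $\theta\le\eta\,[n^{-(1/2+\delta)}\wedge s^{-(1+\delta)}]$ for some small enough constant $\eta$, then for any polynomial time test $\psi$ and an $s$-clique graph $G_*$, we have $$\liminf_{n\to\infty}\Big[\mathbb P_{0,n}(\psi=1)+\max_{\Theta\in\mathcal S(\mathcal G_1(G_* ),\theta)}\mathbb P_{\Theta,n}(\psi=0)\Big]\ge\frac14.$$
   Context: Sparse PCA problem: for distinct indices $i_1,\dots,i_s\in\{1,\dots,d\}$ let $1_{i_1,\dots,i_s}=e_{i_1}+\cdots+e_{i_s}\in\mathbb R^d$, and let $\mathcal S_\sigma=\{I+\sigma 1_{i_1,\dots,i_s}1_{i_1,\dots,i_s}^T\in\mathbb R^{d\times d}: i_1,\dots,i_s\text{ distinct}\}$. Given $n$ i.i.d. samples $Z_1,\dots,Z_n\in\mathbb R^d$, one tests $H_0: Z_i\sim N(0,I)$ versus $H_1: Z_i\sim N(0,\Sigma)$ for some $\Sigma\in\mathcal S_\sigma$; $\mathbb P_{I,n}$ and $\mathbb P_{\Sigma,n}$ denote the corresponding joint laws of the $n$ samples. Computational Hardness of Sparse PCA conjecture: let $\delta>0$ be any fixed small constant. If $\sigma\le\eta[n^{-(1/2+\delta)}\wedge s^{-(1+\delta)}]$ for some small enough constant $\eta$, then for any polynomial time test $\psi$, $\liminf_{n\to\infty}\big[\mathbb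 P_{I,n}(\psi=1)+\max_{\Sigma\in\mathcal S_\sigma}\mathbb P_{\Sigma,n}(\psi=0)\big]\ge\frac14$. A test is a $\{0,1\}$-valued function of the $n$ samples; it is polynomial time if it is computable in time polynomial in the size of the problem. Ising model: for a symmetric $\Theta=(\theta_{ij})\in\mathbb R^{d\times d}$ with zero diagonal and nonnegative entries, $\mathbb P_\Theta(X)\propto\exp\big(\sum_{i,j=1}^d\theta_{ij}X_iX_j\big)$ on $\{\pm1\}^d$; $\mathbb P_{\Theta,n}$ is the joint law of $n$ i.i.d. samples and $\mathbb P_{0,n}$ is the case $\Theta=0$. $G(\Theta)$ is the graph on $\{1,\dots,d\}$ with edges $\{(i,j):\theta_{ij}\ne0\}$. An $s$-clique graph is a graph on $\{1,\dots,d\}$ whose edges are exactly all pairs from some set of $s$ vertices. $\mathcal G_1(G_* )$ is the class of all graphs on $\{1,\dots,d\}$ containing a subgraph isomorphic to $G_*$. For $\theta>0$, $\mathcal S(\mathcal G_1,\theta)=\{\Theta:\Theta=\Theta^T,\ \Theta\text{ has zero diagonal},\ G(\Theta)\in\mathcal G_1,\ \|\Theta\|_F\le1/2,\ \min_{(i,j)\in E[G(\Theta)]}\theta_{ij}\ge\theta\}$, where $\|\cdot\|_F$ is the Frobenius norm. *)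

(* Defs.v *)
From HB Require Import structures.
From mathcomp Require Import all_boot all_order all_algebra.
From mathcomp Require Import all_classical all_reals all_analysis.

Set Implicit Arguments.
Unset Strict Implicit.
Unset Printing Implicit Defensive.

Import Order.TTheory GRing.Theory Num.Theory.
Local Open Scope classical_set_scope.
Local Open Scope ring_scope.

Section power_measure.
Context {dT : measure_display} {T : measurableType dT} {R : realType}.
Local Open Scope ereal_scope.

(* The n-fold product of mu: the law of n i.i.d. samples when mu is a
   probability measure. *)
Fixpoint power_measure (mu : set T -> \bar R) (n : nat) :
    set (n.-tuple T) -> \bar R :=
  match n with
  | 0 => \d_([tuple] : 0.-tuple T)
  | m.+1 => pushforward (mu \x @power_measure mu m)
              (fun p : T * m.-tuple T => [tuple of p.1 :: p.2])
  end.

End power_measure.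

Arguments power_measure {dT T R} mu n _.

Section gaussian.
Context {R : realType}.

Definition mvnormal_pdf (d : nat) (Sigma : 'M[R]_d) (z : d.-tuple R) : R :=
  let x := \row_(j < d) tnth z j in
  (Num.sqrt ((2 * pi) ^+ d * \det Sigma))^-1
    * expR (- (1 / 2) * (x *m invmx Sigma *m x^T) 0 0).

(* N(0, Sigma) on R^d, for Sigma positive definite. *)
Definition mvnormal (d : nat) (Sigma : 'M[R]_d) :
    set (d.-tuple R) -> \bar R :=
  fun A => (\int[power_measure lebesgue_measure d]_(z in A)
              (mvnormal_pdf Sigma z)%:E)%E.

Definition gauss_law (d : nat) (Sigma : 'M[R]_d) (n : nat) :
    set (n.-tuple (d.-tuple R)) -> \bar R :=
  power_measure (mvnormal Sigma) n.

Definition spiked_cov (d s : nat) (sigma : R) : set 'M[R]_d :=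
  [set Sigma | exists2 i : 'I_s -> 'I_d, injective i &
     let v : 'cV[R]_d := \sum_(k < s) delta_mx (i k) 0 in
     Sigma = 1%:M + sigma *: (v *m v^T)].

End gaussian.

Arguments spiked_cov {R} d s sigma _.

(* Polynomial time is measured by while programs for a unit-cost real RAM.

   A machine state has index registers, holding natural numbers, and a real
   memory.  Index registers are named directly; the operands of instructions
   on reals are memory cells whose addresses are read from index registers.
   The only constants are integers, so a program is a finite text, the same
   for all sample sizes. *)

Section real_ram.
Context {R : realType}.

Record state := State { ireg : nat -> nat; rmem : nat -> R }.

Inductive arith := Add | Sub | Mul | Div.

Inductive test :=
  | TestI of nat & nat   (* register x <= register y *)
  | TestR of nat & nat.  (* cell at register x <= cell at register y *)

Inductive prog :=
  | Skip
  | IConst of nat & nat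
  | IAdd of nat & nat & nat
  | ISub of nat & nat & nat
  | RConst of nat & int
  | RArith of arith & nat & nat & nat
  | Seq of prog & prog
  | If of test & prog & prog
  | While of test & prog.

Definition upd (A : Type) (f : nat -> A) (x : nat) (v : A) : nat -> A :=
  fun y => if y == x then v else f y.

Definition iset (st : state) (x v : nat) : state :=
  State (upd (ireg st) x v) (rmem st).

Definition rget (st : state) (x : nat) : R := rmem st (ireg st x).

Definition rset (st : state) (x : nat) (v : R) : state :=
  State (ireg st) (upd (rmem st) (ireg st x) v).

(* Division by 0 returns 0. *)
Definition arith_den (o : arith) (a b : R) : R :=
  match o with
  | Add => a + b
  | Sub => a - b
  | Mul => a * b
  | Div => a / b
  end.

Definition test_den (b : test) (st : state) : bool :=
  match b with
  | TestI x y => (ireg st x <= ireg st y)%N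
  | TestR x y => rget st x <= rget st y
  end.

(* [exec p st t st']: started in [st], [p] halts in [st'] after [t] steps. *)
Inductive exec : prog -> state -> nat -> state -> Prop :=
  | ExecSkip st : exec Skip st 1 st
  | ExecIConst x c st : exec (IConst x c) st 1 (iset st x c)
  | ExecIAdd x y z st :
      exec (IAdd x y z) st 1 (iset st x (ireg st y + ireg st z)%N)
  | ExecISub x y z st :
      exec (ISub x y z) st 1 (iset st x (ireg st y - ireg st z)%N)
  | ExecRConst x c st : exec (RConst x c) st 1 (rset st x c%:~R)
  | ExecRArith o x y z st :
      exec (RArith o x y z) st 1
        (rset st x (arith_den o (rget st y) (rget st z)))
  | ExecSeq p q st1 t1 st2 t2 st3 :
      exec p st1 t1 st2 -> exec q st2 t2 st3 ->
      exec (Seq p q) st1 (t1 + t2)%N st3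
  | ExecIfTrue b p q st t st' :
      test_den b st -> exec p st t st' -> exec (If b p q) st t.+1 st'
  | ExecIfFalse b p q st t st' :
      ~~ test_den b st -> exec q st t st' -> exec (If b p q) st t.+1 st'
  | ExecWhileFalse b p st :
      ~~ test_den b st -> exec (While b p) st 1 st
  | ExecWhileTrue b p st1 t1 st2 t2 st3 :
      test_den b st1 -> exec p st1 t1 st2 -> exec (While b p) st2 t2 st3 ->
      exec (While b p) st1 (t1 + t2).+1 st3.

(* Input: n, d and s in index registers 0, 1 and 2, and the n x d sample
   matrix in the real memory, row by row; everything else is 0. *)
Definition init_state (T : Type) (e : T -> R) (n d s : nat)
    (Z : n.-tuple (d.-tuple T)) : state :=
  State (nth 0%N [:: n; d; s])
        (nth 0 [seq e x | x <- flatten [seq tval z | z <- tval Z]]).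

(* The entries of the samples have type T and are read by the machine through
   the embedding e; the answer is read in index register 0. *)
Definition poly_time_test (T : Type) (e : T -> R) (d s : nat -> nat)
    (psi : forall n, n.-tuple ((d n).-tuple T) -> bool) : Prop :=
  exists (p : prog) (c k : nat),
    forall (n : nat) (Z : n.-tuple ((d n).-tuple T)),
      exists (t : nat) (st : state),
        [/\ exec p (init_state e (s n) Z) t st,
            (t <= c * (n * d n).+1 ^ k)%N
          & psi n Z = (0 < ireg st 0)%N].

End real_ram.

Arguments state R : clear implicits.

Section sparse_pca.
Context {R : realType}.

Definition signal_bound (delta : R) (n s : nat) : R :=
  Num.min (n%:R `^ (- (1 / 2 + delta))) (s%:R `^ (- (1 + delta))).

Definition sparse_pca_risk (d s n : nat) (sigma : R)
    (psi : n.-tuple (d.-tuple R) -> bool) : \bar R :=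
  (gauss_law 1%:M [set Z | psi Z]
    + ereal_sup [set gauss_law Sigma [set Z | ~~ psi Z]
                | Sigma in spiked_cov d s sigma])%E.

Definition sparse_pca_conjecture (d s : nat -> nat) : Prop :=
  forall delta : R, 0 < delta ->
  exists2 eta : R, 0 < eta &
    forall sigma : nat -> R,
      (forall n, (0 < n)%N ->
         0 < sigma n <= eta * signal_bound delta n (s n)) ->
    forall psi : forall n, n.-tuple ((d n).-tuple R) -> bool,
      poly_time_test id s psi ->
      ((1 / 4)%:E <=
        limn_einf (fun n => sparse_pca_risk (s n) (sigma n) (psi n)))%E.

End sparse_pca.

Arguments sparse_pca_conjecture R d s : clear implicits.

Section graphs.
Context {d : nat}.
Implicit Types G H : rel 'I_d.

Definition simple_graph G : Prop := symmetric G /\ irreflexive G.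

Definition clique_graph (s : nat) G : Prop :=
  exists2 S : {set 'I_d}, #|S| = s &
    forall i j, G i j = [&& i \in S, j \in S & i != j].

Definition graphs_containing H : set (rel 'I_d) :=
  [set G | simple_graph G /\
     exists2 f : 'I_d -> 'I_d, injective f &
       forall i j, H i j -> G (f i) (f j)].

End graphs.

Section ising.
Context {R : realType}.

Definition spin (b : bool) : R := if b then 1 else -1.

Definition ising_weight (d : nat) (Theta : 'M[R]_d) (x : d.-tuple bool) : R :=
  expR (\sum_(i < d) \sum_(j < d)
          Theta i j * spin (tnth x i) * spin (tnth x j)).

Definition ising_pmf (d : nat) (Theta : 'M[R]_d) (x : d.-tuple bool) : R :=
  ising_weight Theta x / \sum_(y : d.-tuple bool) ising_weight Theta y.

Definition ising_law (d : nat) (Theta : 'M[R]_d) (n : nat)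
    (A : {pred n.-tuple (d.-tuple bool)}) : R :=
  \sum_(X in A) \prod_(i < n) ising_pmf Theta (tnth X i).

(* The norm `|Theta| of the library is the maximum norm. *)
Definition frobenius (d : nat) (Theta : 'M[R]_d) : R :=
  Num.sqrt (\sum_(i < d) \sum_(j < d) Theta i j ^+ 2).

Definition graph_of (d : nat) (Theta : 'M[R]_d) : rel 'I_d :=
  fun i j => Theta i j != 0.

Definition ising_class (d : nat) (C : set (rel 'I_d)) (theta : R) :
    set 'M[R]_d :=
  [set Theta | [/\ Theta = Theta^T,
                   forall i, Theta i i = 0,
                   C (graph_of Theta),
                   frobenius Theta <= 1 / 2
                 & forall i j, graph_of Theta i j -> theta <= Theta i j]].

Definition ising_risk (d n : nat) (C : set (rel 'I_d)) (theta : R)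
    (psi : n.-tuple (d.-tuple bool) -> bool) : \bar R :=
  ((ising_law 0 [pred X | psi X])%:E
    + ereal_sup [set (ising_law Theta [pred X | ~~ psi X])%:E
                | Theta in ising_class C theta])%E.

End ising.

(* Main.v *)
From HB Require Import structures.
From mathcomp Require Import lra.
Require Import Defs.
From mathcomp Require Import all_boot all_order all_algebra.
From mathcomp Require Import all_classical all_reals all_analysis.
From mathcomp Require Import measurable_realfun zify.
Import Order.TTheory GRing.Theory Num.Theory numFieldNormedType.Exports.
Set Implicit Arguments.
Unset Strict Implicit.
Unset Printing Implicit Defensive.
Local Open Scope ring_scope.

(** Take the coordinatewise signs of the Gaussian samples.  Under the null
    hypothesis they are uniform on the cube.  Under the spiked covariance with
    spike on S, conditionally on a standard normal g the signs are independent
    and, in S, have mean h(g), which is b g up to a cubic error.  The Ising law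
    on the clique S is, by the Gaussian (Hubbard-Stratonovich) identity, the
    normalisation of a mixture over g of exp (b g M - s (b g)^2 / 2), with M the
    sum of the spins in S and theta = b^2 / (2 (1 + s b^2)).  Comparing both
    mixtures in L2 of the uniform law, conditionally on g, shows that the
    chi-square divergence of the two laws of one sample is O(theta^2) as long as
    s theta is small; hence the joint laws of n samples merge as soon as
    n theta^2 -> 0.  A polynomial time test for the Ising model thus gives one
    for sparse PCA whose risk is, asymptotically, at most as large. *)

(** * Signs of the samples on the real RAM *)

Section sign_program.
Context {R : realType}.

(** The signal bound only gives [n theta^2 -> 0] and [s theta] below a small constant, so the
    divergence of one sample must be O(b^4) with no power of s left over, although s spins are
    compared. The slope of the mean sign at 0 is therefore absorbed in the spike: both conditional
    means then agree with y = b g up to order y^3, and the normaliser of one tilted spin is 1 up to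
    order y^4. These errors enter the squared distance as s y^6 and s^2 y^8, and every surplus
    factor s is paid by s b^2 <= 1/16. The same bound keeps the accompanying factor exp (2 s y^2)
    integrable against the normal law of g. The Ising mixture is a density only up to a constant,
    which is never estimated: the chi-square sum is maximised over it. The null laws agree exactly
    after taking signs, so the whole error sits in the errors of the second kind. *)

Definition sgb (x : R) : bool := 0 <= x.

Definition signs (d n : nat) (Z : n.-tuple (d.-tuple R)) :
    n.-tuple (d.-tuple bool) :=
  map_tuple (map_tuple sgb) Z.

(** Index registers cannot be multiplied, so [n * d] is built in register 3 by adding [d] to it [n]
    times. Register 4 is never written and serves as the constant 0. *)
Definition size_prog : prog :=
  Seq (IConst 5 1) (Seq (IConst 6 1)
    (While (TestI 6 0) (Seq (IAdd 3 3 1) (IAdd 6 6 5)))).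

(* Register 7 points to the first cell behind the data, which contains 0. *)
Definition sign_loop : prog :=
  While (TestI 5 3)
    (Seq (ISub 3 3 5) (If (TestR 7 3) (RConst 3 1) (RConst 3 (-1)))).

(** [IAdd 7 3 4] is a copy, register 4 being 0. The closing assignments clear the scratch registers,
    since the next program must start in exactly the initial state of the sign matrix. *)
Definition sign_prog : prog :=
  Seq size_prog (Seq (IAdd 7 3 4) (Seq sign_loop
    (Seq (IConst 5 0) (Seq (IConst 6 0) (IConst 7 0))))).

Definition regs (n d s a b c e : nat) : nat -> nat :=
  nth 0%N [:: n; d; s; a; 0%N; b; c; e].

Local Ltac regs_ext :=
  rewrite /regs /=; try congr State; apply/funext => -[|[|[|[|[|[|[|[|?]]]]]]]] //=;
  rewrite /upd /= ?nth_nil.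

Lemma exec_size_loop n d s (m : nat -> R) i k : (i + k = n)%N ->
  exec (While (TestI 6 0) (Seq (IAdd 3 3 1) (IAdd 6 6 5)))
    (State (regs n d s (i * d) 1 i.+1 0) m) (3 * k).+1
    (State (regs n d s (n * d) 1 n.+1 0) m).
Proof.
elim: k i => [|k IH] i ikn.
  move: ikn; rewrite addn0 => ->; apply: ExecWhileFalse.
  by rewrite /= ltnn.
have -> : (3 * k.+1).+1 = ((1 + 1) + (3 * k).+1).+1 by rewrite mulnS.
apply: (@ExecWhileTrue _ _ _ _ _ (State (regs n d s (i.+1 * d) 1 i.+2 0) m)).
- by rewrite /= -ikn -addSnnS leq_addr.
- apply: (@ExecSeq _ _ _ _ _ (State (regs n d s (i.+1 * d) 1 i.+1 0) m)).
    have := @ExecIAdd R 3 3 1 (State (regs n d s (i * d) 1 i.+1 0) m).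
    congr exec; rewrite /iset; regs_ext.
    by rewrite /upd /= mulSn addnC.
  have := @ExecIAdd R 6 6 5 (State (regs n d s (i.+1 * d) 1 i.+1 0) m).
  congr exec; rewrite /iset; regs_ext.
  by rewrite /upd /= addn1.
- by apply: IH; rewrite addSnnS.
Qed.

(** The loop runs downwards through the data, so that one register is both counter and address and
    is back at 0 at the end. *)
Definition partial_signs (N k : nat) (m : nat -> R) : nat -> R :=
  fun a => if (k <= a < N)%N then spin (sgb (m a)) else m a.

(** Cell [N] stays 0 throughout, so comparing it with a data cell tests the sign. A turn costs four
    steps: loop test, decrement, branch and write. *)
Lemma exec_sign_loop n d s N (m : nat -> R) k : m N = 0 -> (k <= N)%N ->
  exec sign_loop
    (State (regs n d s k 1 n.+1 N) (partial_signs N k m)) (4 * k).+1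
    (State (regs n d s 0 1 n.+1 N) (partial_signs N 0 m)).
Proof.
move=> mN; elim: k => [|k IH] kN; first exact: ExecWhileFalse.
have -> : (4 * k.+1).+1 = ((1 + 2) + (4 * k).+1).+1 by rewrite mulnS.
apply: (@ExecWhileTrue _ _ _ _ _
  (State (regs n d s k 1 n.+1 N) (partial_signs N k m))) => //; last first.
  exact: IH (ltnW kN).
apply: (@ExecSeq _ _ _ _ _
    (State (regs n d s k 1 n.+1 N) (partial_signs N k.+1 m))).
  have := @ExecISub R 3 3 5 (State (regs n d s k.+1 1 n.+1 N) (partial_signs N k.+1 m)).
  congr exec; rewrite /iset; regs_ext.
  by rewrite /upd /= subn1.
have testE : test_den (TestR 7 3) (State (regs n d s k 1 n.+1 N) (partial_signs N
  k.+1 m)) = sgb (m k).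
  by rewrite /= /rget /= /partial_signs !ltnn andbF mN.
have updE v : v = spin (sgb (m k)) :> R ->
  rset (State (regs n d s k 1 n.+1 N) (partial_signs N k.+1 m)) 3 v =
  State (regs n d s k 1 n.+1 N) (partial_signs N k m).
  move=> ->; rewrite /rset /=; congr State; apply/funext => a.
  rewrite /upd /partial_signs; case: eqP => [->|/eqP ak]; first by rewrite leqnn kN.
  by rewrite ltn_neqAle eq_sym ak.
case sgk: (sgb (m k)) testE => testE.
  apply: ExecIfTrue; first by rewrite testE.
  by rewrite -(updE 1%:~R); [exact: ExecRConst|rewrite sgk].
apply: ExecIfFalse; first by rewrite testE.
by rewrite -(updE (-1)%:~R); [exact: ExecRConst|rewrite sgk /= mulrNz].
Qed.

Lemma size_flatten_tuple (T : Type) d n (Z : n.-tuple (d.-tuple T)) :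
  size (flatten [seq tval z | z <- tval Z]) = (n * d)%N.
Proof.
case: Z => Z /= /eqP <-; elim: Z => //= z Z IH.
by rewrite size_cat IH size_tuple mulSn.
Qed.

Lemma exec_sign_prog n d s (Z : n.-tuple (d.-tuple R)) :
  exec sign_prog (init_state id s Z) (3 * n + 4 * (n * d) + 8)
    (init_state (@spin R) s (signs Z)).
Proof.
set m := nth 0 [seq x | x <- flatten [seq tval z | z <- tval Z]].
have mout a : (n * d <= a)%N -> m a = 0.
  by move=> le_a; rewrite /m nth_default// map_id size_flatten_tuple.
have -> : init_state id s Z = State (regs n d s 0 0 0 0) m.
  by rewrite /init_state; regs_ext.
have -> : init_state (@spin R) s (signs Z) =
          State (regs n d s 0 0 0 0) (partial_signs (n * d) 0 m).
  rewrite /init_state; congr State; first by regs_ext.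
  have -> : [seq spin x | x <- flatten [seq tval z | z <- signs Z]] =
            [seq spin (sgb x) | x <- flatten [seq tval z | z <- tval Z]] :> seq R.
    rewrite !map_flatten /= -!map_comp; congr flatten.
    by apply: eq_map => z /=; rewrite -map_comp.
  apply/funext => a; rewrite /partial_signs leq0n /=.
  case: ltnP => le_a; last first.
    by rewrite mout// nth_default// size_map size_flatten_tuple.
  by rewrite (nth_map 0) ?size_flatten_tuple// /m map_id.
(* The step count is regrouped along the nesting of [Seq]. *)
have -> : (3 * n + 4 * (n * d) + 8 =
   (1 + (1 + (3 * n).+1)) + (1 + ((4 * (n * d)).+1 + (1 + (1 + 1)))))%N by lia.
apply: (@ExecSeq _ _ _ _ _ (State (regs n d s (n * d) 1 n.+1 0) m)).
  apply: (@ExecSeq _ _ _ _ _ (State (regs n d s 0 1 0 0) m)).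
    have := @ExecIConst R 5 1 (State (regs n d s 0 0 0 0) m).
    by congr exec; rewrite /iset; regs_ext.
  apply: (@ExecSeq _ _ _ _ _ (State (regs n d s (0 * d) 1 1 0) m)).
    have := @ExecIConst R 6 1 (State (regs n d s 0 1 0 0) m).
    by congr exec; rewrite /iset; regs_ext.
  exact: exec_size_loop.
apply: (@ExecSeq _ _ _ _ _ (State (regs n d s (n * d) 1 n.+1 (n * d)) m)).
  have := @ExecIAdd R 7 3 4 (State (regs n d s (n * d) 1 n.+1 0) m).
  congr exec; rewrite /iset; regs_ext.
  by rewrite /upd /= addn0.
apply: ExecSeq.
  have {1}-> : m = partial_signs (n * d) (n * d) m.
    by apply/funext => a; rewrite /partial_signs; case: ltnP;
      rewrite ?andbF ?andbT// => /ltn_geF ->.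
  by apply: exec_sign_loop => //; exact: mout.
set m' := partial_signs _ _ _.
apply: (@ExecSeq _ _ _ _ _ (State (regs n d s 0 0 n.+1 (n * d)) m')).
  have := @ExecIConst R 5 0 (State (regs n d s 0 1 n.+1 (n * d)) m').
  by congr exec; rewrite /iset; regs_ext.
apply: (@ExecSeq _ _ _ _ _ (State (regs n d s 0 0 0 (n * d)) m')).
  have := @ExecIConst R 6 0 (State (regs n d s 0 0 n.+1 (n * d)) m').
  by congr exec; rewrite /iset; regs_ext.
have := @ExecIConst R 7 0 (State (regs n d s 0 0 0 (n * d)) m').
by congr exec; rewrite /iset; regs_ext.
Qed.

(** Positive dimension bounds the 3 n steps of the size loop by a multiple of n d. Raising the
    exponent by one absorbs this linear overhead even when [k] is 0. *)
Lemma poly_time_test_signs (d s : nat -> nat)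
    (psi : forall n, n.-tuple ((d n).-tuple bool) -> bool) :
  (forall n, (0 < d n)%N) -> poly_time_test (@spin R) s psi ->
  poly_time_test (@id R) s (fun n Z => psi n (signs Z)).
Proof.
move=> d_gt0 [p [c [k pP]]]; exists (Seq sign_prog p), (8 + c)%N, k.+1 => n Z.
have [t [st [ex tle ->]]] := pP n (signs Z).
exists (3 * n + 4 * (n * d n) + 8 + t)%N, st; split => //.
  exact: ExecSeq (exec_sign_prog _ _) ex.
rewrite mulnDl leq_add//.
  have nd : (n <= n * d n)%N by rewrite leq_pmulr.
  apply: (@leq_trans (8 * (n * d n).+1)); first by lia.
  by rewrite leq_mul2l /= expnS leq_pmulr// expn_gt0.
by apply: leq_trans tle _; rewrite leq_mul2l leq_pexp2l ?orbT.
Qed.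

End sign_program.

(** * Chi-square divergence and products *)

Section finite_products.
Context {R : realType} {K : finType}.
Implicit Types p q : K -> R.

Lemma sum_tuple_prod n (F : 'I_n -> K -> R) :
  \sum_(X : n.-tuple K) \prod_(i < n) F i (tnth X i) =
  \prod_(i < n) \sum_k F i k.
Proof.
rewrite bigA_distr_bigA /=.
rewrite (reindex (fun f : {ffun 'I_n -> K} => [tuple f i | i < n])) /=.
  by apply: eq_bigr => f _; apply: eq_bigr => i _; rewrite tnth_mktuple.
exists (fun X : n.-tuple K => [ffun i => tnth X i]) => [f|X] _.
  by apply/ffunP => i; rewrite ffunE tnth_mktuple.
by apply: eq_from_tnth => i; rewrite tnth_mktuple ffunE.
Qed.

Lemma sum_tuple_exp n (f : K -> R) :
  \sum_(X : n.-tuple K) \prod_(i < n) f (tnth X i) = (\sum_k f k) ^+ n.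
Proof. by rewrite (sum_tuple_prod (fun=> f)) prodr_const card_ord. Qed.

(* Cauchy-Schwarz against p bounds the total variation by the chi-square
   divergence, which is multiplicative over independent samples. *)
Lemma sum_le_chi_square p q : (forall k, 0 < p k) ->
  \sum_k p k = 1 -> \sum_k q k = 1 -> forall A : pred K,
  \sum_(k in A) q k <= \sum_(k in A) p k + Num.sqrt (\sum_k q k ^+ 2 / p k - 1).
Proof.
move=> p_gt0 p1 q1 A; pose D := \sum_k `|q k - p k|.
have D_ge0 : 0 <= D by apply: sumr_ge0.
have DE : \sum_k (q k - p k) ^+ 2 / p k = \sum_k q k ^+ 2 / p k - 1.
  have -> : \sum_k q k ^+ 2 / p k - 1 =
      \sum_k (q k ^+ 2 / p k - 2 * q k + p k).
    by rewrite big_split /= sumrB -mulr_sumr p1 q1; lra.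
  apply: eq_bigr => k _; have := mulfV (lt0r_neq0 (p_gt0 k)) => pV.
  rewrite sqrrB mulrDl mulrBl; congr (_ - _ + _).
    by rewrite -mulr_natl -!mulrA pV mulr1.
  by rewrite expr2 -mulrA pV mulr1.
have D2 : D ^+ 2 <= \sum_k q k ^+ 2 / p k - 1.
  rewrite -DE -subr_ge0.
  (* The gap in Cauchy-Schwarz is the variance under [p] of [|q - p| / p], hence nonnegative. *)
  have -> : \sum_k (q k - p k) ^+ 2 / p k - D ^+ 2 =
      \sum_k p k * (`|q k - p k| / p k - D) ^+ 2.
    transitivity (\sum_k ((q k - p k) ^+ 2 / p k - 2 * D * `|q k - p k| + D ^+ 2 * p k)).
      by rewrite big_split /= sumrB -!mulr_sumr p1 -/D; lra.
    apply: eq_bigr => k _; have := mulfV (lt0r_neq0 (p_gt0 k)) => pV.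
    rewrite -(real_normK (num_real (q k - p k))).
    move: pV; set c := `|_|; set P := (p k)^-1; set pk := p k => pV.
    have -> : pk * (c * P - D) ^+ 2 = (pk * P) * (c ^+ 2 * P) - 2 * D * c * (pk * P)
      + D ^+ 2 * pk.
      by lra.
    by rewrite pV; lra.
  by apply: sumr_ge0 => k _; rewrite mulr_ge0 ?sqr_ge0// ltW.
apply: (@le_trans _ _ (\sum_(k in A) p k + D)); last first.
  rewrite lerD2l -(ger0_norm D_ge0) -sqrtr_sqr ler_sqrt//.
  exact: le_trans (sqr_ge0 _) D2.
rewrite -lerBlDl -sumrB (le_trans (ler_norm _))// (le_trans (ler_norm_sum _ _ _))//.
by rewrite /D [leRHS](bigID (mem A))/= lerDl sumr_ge0.
Qed.

End finite_products.

Lemma sum_tuple_le_chi_square {R : realType} {K : finType} (p q : K -> R) n (A : pred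
  (n.-tuple K)) :
  (forall k, 0 < p k) -> \sum_k p k = 1 -> \sum_k q k = 1 ->
  \sum_(X in A) \prod_(i < n) q (tnth X i) <=
  \sum_(X in A) \prod_(i < n) p (tnth X i)
    + Num.sqrt ((\sum_k q k ^+ 2 / p k) ^+ n - 1).
Proof.
move=> p_gt0 p1 q1.
have -> : (\sum_k q k ^+ 2 / p k) ^+ n = \sum_(X : n.-tuple K)
    (\prod_(i < n) q (tnth X i)) ^+ 2 / \prod_(i < n) p (tnth X i).
  by rewrite -sum_tuple_exp; apply: eq_bigr => X _; rewrite -prodrXl -prodf_div.
apply: sum_le_chi_square; rewrite ?sum_tuple_exp ?p1 ?q1 ?expr1n// => X.
by apply: prodr_gt0.
Qed.

(** * The uniform law on the cube *)

Section cube.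
Context {R : realType} {d : nat}.
Implicit Types (S : {set 'I_d}) (F G : d.-tuple bool -> R) (x : d.-tuple bool).

Definition umean F : R := (\sum_x F x) / 2 ^+ d.

Lemma umeanD F G : umean (fun x => F x + G x) = umean F + umean G.
Proof. by rewrite /umean big_split /= mulrDl. Qed.

Lemma umeanZ c F : umean (fun x => c * F x) = c * umean F.
Proof. by rewrite /umean -mulr_sumr mulrA. Qed.

Lemma ler_umean F G : (forall x, F x <= G x) -> umean F <= umean G.
Proof.
by move=> FG; rewrite ler_wpM2r ?invr_ge0 ?exprn_ge0// ler_sum.
Qed.

Lemma eq_umean F G : F =1 G -> umean F = umean G.
Proof. by move=> FG; congr (_ / _); apply: eq_bigr. Qed.

Lemma umean_prod S (f : bool -> R) :
  umean (fun x => \prod_(j in S) f (tnth x j)) =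
  ((f true + f false) / 2) ^+ #|S|.
Proof.
rewrite /umean; under eq_bigr do rewrite big_mkcond.
rewrite (sum_tuple_prod (fun i k => if i \in S then f k else 1)).
rewrite (_ : 2 ^+ d = \prod_(i < d) (2 : R)); last by rewrite prodr_const card_ord.
rewrite -prodf_div -prodr_const [RHS]big_mkcond; apply: eq_bigr => i _.
by rewrite big_bool; case: (i \in S) => //; rewrite divff// lt0r_neq0// addr_gt0.
Qed.

(** For [|h| <= 1], this is the density, with respect to the uniform law, of independent spins with
    mean [h] on [S] and mean 0 elsewhere. *)
Definition lin_prod S (h : R) x : R := \prod_(j in S) (1 + spin (tnth x j) * h).

Lemma umean_lin_prodM S h t :
  umean (fun x => lin_prod S h x * lin_prod S t x) = (1 + h * t) ^+ #|S|.
Proof.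
rewrite (_ : 1 + h * t = ((1 + spin true * h) * (1 + spin true * t) +
   (1 + spin false * h) * (1 + spin false * t)) / 2); last by rewrite /spin; lra.
rewrite -(umean_prod S (fun b => (1 + spin b * h) * (1 + spin b * t))).
by apply: eq_umean => x; rewrite -big_split.
Qed.

Lemma umean_lin_prodB S h t :
  umean (fun x => (lin_prod S h x - lin_prod S t x) ^+ 2) =
  (1 + h ^+ 2) ^+ #|S| - 2 * (1 + h * t) ^+ #|S| + (1 + t ^+ 2) ^+ #|S|.
Proof.
rewrite (@eq_umean _ (fun x => (lin_prod S h x * lin_prod S h x +
   -2 * (lin_prod S h x * lin_prod S t x)) + lin_prod S t x * lin_prod S t x)).
  by rewrite !umeanD umeanZ !umean_lin_prodM -!expr2 mulNr.
by move=> x; lra.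
Qed.

End cube.

(** * Second differences of powers and the distance conditional on g *)

Section power_differences.
Context {R : realType}.
Implicit Types h t w : R.

Lemma normr_subrXX_le (a b K : R) n : `|a| <= K -> `|b| <= K -> 1 <= K ->
  `|a ^+ n - b ^+ n| <= n%:R * `|a - b| * K ^+ n.
Proof.
move=> aK bK K1; have K0 : 0 <= K by rewrite (le_trans _ K1).
elim: n => [|n IH]; first by rewrite subrr normr0 !mul0r.
have -> : a ^+ n.+1 - b ^+ n.+1 = a * (a ^+ n - b ^+ n) + (a - b) * b ^+ n.
  by rewrite !exprS; lra.
apply: le_trans (ler_normD _ _) _; rewrite !normrM normrX.
rewrite -natr1 mulrDl mul1r [leRHS]mulrDl lerD//.
  rewrite [leRHS](_ : _ = K * (n%:R * `|a - b| * K ^+ n)); last by rewrite exprS; lra.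
  by rewrite ler_pM.
rewrite ler_wpM2l// (@le_trans _ _ (K ^+ n))//; first by rewrite lerXn2r ?nnegrE.
by rewrite exprS ler_peMl// exprn_ge0.
Qed.

Lemma power_square_diff_le h t w n :
  h ^+ 2 <= w -> t ^+ 2 <= w ->
  (1 + h ^+ 2) ^+ n - 2 * (1 + h * t) ^+ n + (1 + t ^+ 2) ^+ n <=
  (h - t) ^+ 2 * n%:R * (1 + n%:R * w) * (1 + w) ^+ n.
Proof.
move=> hw tw; have w0 : 0 <= w by rewrite (le_trans (sqr_ge0 h)).
have K1 : 1 <= 1 + w by rewrite lerDl.
have nht : `|h * t| <= w.
  rewrite ler_norml; apply/andP; split.
    have := sqr_ge0 (h + t); rewrite sqrrD; lra.
  have := sqr_ge0 (h - t); rewrite sqrrB; lra.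
elim: n => [|n IH]; first by rewrite !expr0 !mulr0 !mul0r; lra.
set D := _ - _ + _ in IH; set a := (1 + h ^+ 2); set b := 1 + h * t.
(* In the last term [a - b] is [h * (h - t)], so [a ^+ n - b ^+ n] supplies the second factor h -
   t. *)
have -> : (1 + h ^+ 2) ^+ n.+1 - 2 * (1 + h * t) ^+ n.+1 + (1 + t ^+ 2) ^+ n.+1 =
    (1 + t ^+ 2) * D + (h - t) ^+ 2 * a ^+ n + 2 * t * (h - t) * (a ^+ n - b ^+ n).
  by rewrite /D /a /b !exprS; lra.
have a_ge0 : 0 <= a by rewrite addr_ge0 ?sqr_ge0.
have cross : 2 * t * (h - t) * (a ^+ n - b ^+ n) <=
    2 * (h - t) ^+ 2 * w * n%:R * (1 + w) ^+ n.
  apply: le_trans (ler_norm _) _; rewrite normrM.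
  have na : `|a| <= 1 + w by rewrite ger0_norm// lerD2l.
  have nb : `|b| <= 1 + w by rewrite (le_trans (ler_normD _ _))// normr1 lerD2l.
  apply: le_trans (ler_wpM2l (normr_ge0 _) (normr_subrXX_le n na nb K1)) _.
  have -> : a - b = h * (h - t) by rewrite /a /b; lra.
  rewrite !normrM normr_nat -(real_normK (num_real (h - t))).
  set K := _ ^+ n; set u := `|h - t|.
  have -> : 2 * `|t| * u * (n%:R * (`|h| * u) * K) = `|h * t| * (2 * u ^+ 2 * n%:R * K).
    by rewrite normrM; lra.
  have -> : 2 * u ^+ 2 * w * n%:R * K = w * (2 * u ^+ 2 * n%:R * K) by lra.
  rewrite ler_wpM2r// /K /u !mulr_ge0// ?exprn_ge0// ?addr_ge0//.
have aK : (h - t) ^+ 2 * a ^+ n <= (h - t) ^+ 2 * (1 + w) ^+ n.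
  apply: ler_wpM2l; first exact: sqr_ge0.
  by apply: lerXn2r; rewrite ?nnegrE ?(le_trans ler01 K1)// lerD2l.
set E := _ * (1 + w) ^+ n in IH.
have E0 : 0 <= E.
  apply: mulr_ge0; last by rewrite exprn_ge0// addr_ge0.
  by apply: mulr_ge0; [exact: mulr_ge0 (sqr_ge0 _) (ler0n _ _)|rewrite addr_ge0// mulr_ge0].
have tD : (1 + t ^+ 2) * D <= (1 + w) * E.
  apply: (@le_trans _ _ ((1 + t ^+ 2) * E)).
    by rewrite ler_wpM2l// addr_ge0 ?sqr_ge0.
  by rewrite ler_wpM2r// lerD2l.
apply: le_trans (lerD (lerD tD aK) cross) _.
rewrite /E [(1 + w) ^+ n.+1]exprS -[n.+1%:R]natr1 -subr_ge0; set N := n%:R;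
  set K := (1 + w) ^+ n.
have N0 : 0 <= N by rewrite /N.
have K0 : 0 <= K by rewrite /K exprn_ge0// addr_ge0.
rewrite [X in 0 <= X](_ : _ =
    ((h - t) ^+ 2 * K) * (2 * w + (2 * N + 1) * w ^+ 2)); last by lra.
apply: mulr_ge0; first exact: mulr_ge0 (sqr_ge0 _) K0.
by apply: addr_ge0; [lra|apply: mulr_ge0; [lra|exact: sqr_ge0]].
Qed.

Lemma exprn_1D_le (w : R) n : 0 <= w -> (1 + w) ^+ n <= expR (n%:R * w).
Proof.
move=> w0; rewrite mulrC expRM_natr lerXn2r ?nnegrE ?expR_ge0 ?addr_ge0//.
exact: expR_ge1Dx.
Qed.

Lemma one_subXn_le (r : R) n : 0 <= r <= 1 -> 0 <= 1 - r ^+ n <= n%:R * (1 - r).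
Proof.
move=> /andP[r0 r1]; rewrite subr_ge0 exprn_ile1//=.
elim: n => [|n IH]; first by rewrite subrr mul0r.
have := exprn_ge0 n r0; have := exprn_ile1 n r0 r1; rewrite exprS -natr1; nra.
Qed.

(** Meant for the two conditional densities given g: [h] is the mean sign, [t] is [tanh y] and [r]
    the normaliser [cosh_gauss y]. The first error term comes from the means, the second from the
    normaliser. *)
Lemma umean_exp_dist (d : nat) (S : {set 'I_d}) (h t r y c : R) :
  h ^+ 2 <= y ^+ 2 -> t ^+ 2 <= y ^+ 2 -> (h - t) ^+ 2 <= c * y ^+ 6 ->
  0 <= r <= 1 -> 1 - r <= y ^+ 4 ->
  umean (fun x => (lin_prod S h x - r ^+ #|S| * lin_prod S t x) ^+ 2) <=
  (2 * c * #|S|%:R * y ^+ 6 + 2 * #|S|%:R ^+ 2 * y ^+ 8) *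
  expR (2 * (#|S|%:R * y ^+ 2)).
Proof.
set s := #|S| => hy ty htc r01 ry.
have rs := one_subXn_le s r01.
apply: (@le_trans _ _ (umean (fun x => 2 * (lin_prod S h x - lin_prod S t x) ^+ 2 +
    2 * (1 - r ^+ s) ^+ 2 * (lin_prod S t x * lin_prod S t x)))).
  apply: ler_umean => x; rewrite -subr_ge0.
  (* With u the difference of the products and v = (1 - r^s) [lin_prod S t x], this is 2 u^2 + 2 v^2
     - (u + v)^2 = (u - v)^2. *)
  have -> : 2 * (lin_prod S h x - lin_prod S t x) ^+ 2 +
    2 * (1 - r ^+ s) ^+ 2 * (lin_prod S t x * lin_prod S t x) -
    (lin_prod S h x - r ^+ s * lin_prod S t x) ^+ 2 =
    (lin_prod S h x - lin_prod S t x - (1 - r ^+ s) * lin_prod S t x) ^+ 2 by lra.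
  exact: sqr_ge0.
rewrite umeanD !umeanZ umean_lin_prodB umean_lin_prodM -/s -expr2.
have w0 : 0 <= y ^+ 2 by exact: sqr_ge0.
have N0 : 0 <= s%:R :> R by [].
set E := expR (s%:R * y ^+ 2).
have E1 : (1 + y ^+ 2) ^+ s <= E by exact: exprn_1D_le.
have EE : expR (2 * (s%:R * y ^+ 2)) = E * E by rewrite -expRD; congr expR; lra.
have E2 : 1 + s%:R * y ^+ 2 <= E by exact: expR_ge1Dx.
have E3 : 1 <= E by rewrite (le_trans _ E2)// lerDl mulr_ge0.
have E0 : 0 <= E by exact: expR_ge0.
have h1 : (1 + h ^+ 2) ^+ s - 2 * (1 + h * t) ^+ s + (1 + t ^+ 2) ^+ s <=
    c * s%:R * y ^+ 6 * (E * E).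
  apply: le_trans (power_square_diff_le s hy ty) _.
  rewrite [leRHS](_ : _ = (c * y ^+ 6) * s%:R * E * E); last by lra.
  have K0 : 0 <= (1 + y ^+ 2) ^+ s by rewrite exprn_ge0// addr_ge0.
  have g1 : 0 <= (h - t) ^+ 2 * s%:R by exact: mulr_ge0 (sqr_ge0 _) N0.
  have g2 : 0 <= 1 + s%:R * y ^+ 2 by rewrite addr_ge0// mulr_ge0.
  apply: ler_pM => //; first exact: mulr_ge0.
  by apply: ler_pM => //; rewrite ler_wpM2r.
have h2 : (1 - r ^+ s) ^+ 2 * (1 + t ^+ 2) ^+ s <= s%:R ^+ 2 * y ^+ 8 * (E * E).
  case/andP: rs => rs0 rs1.
  apply: ler_pM; rewrite ?sqr_ge0 ?exprn_ge0 ?addr_ge0 ?sqr_ge0//.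
    rewrite [leRHS](_ : _ = (s%:R * y ^+ 4) ^+ 2); last by lra.
    apply: lerXn2r; rewrite ?nnegrE//; first by rewrite mulr_ge0 ?exprn_even_ge0.
    by rewrite (le_trans rs1)// ler_wpM2l.
  apply: (@le_trans _ _ ((1 + y ^+ 2) ^+ s)); last by rewrite (le_trans E1)// ler_peMl.
  by apply: lerXn2r; rewrite ?nnegrE ?addr_ge0 ?sqr_ge0// lerD2l.
by rewrite EE; lra.
Qed.

End power_differences.

(** * Hyperbolic functions *)

Section hyperbolic.
Context {R : realType}.
Implicit Types x y : R.

Lemma ge0_is_derive_ge (f df : R -> R) : (forall x, is_derive x 1 f (df x)) ->
  (forall x, 0 <= x -> 0 <= df x) -> forall y, 0 <= y -> f 0 <= f y.
Proof.
move=> fdf df_ge0 y y0; apply: (@ger0_derive1_ndecry R f 0) => //.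
- by move=> x; rewrite in_itv /= andbT => x0; rewrite derive1E derive_val df_ge0// ltW.
- apply: continuous_subspaceT => x.
  by apply: differentiable_continuous; apply/derivable1_diffP.
Qed.

Definition cosh x : R := (expR x + expR (- x)) / 2.
Definition sinh x : R := (expR x - expR (- x)) / 2.
Definition tanh x : R := sinh x / cosh x.

Lemma is_derive_expRN x : is_derive x 1 (fun z => expR (- z)) (- expR (- x)).
Proof.
by apply: is_derive_eq (is_derive1_comp (is_derive_expR (- x)) (is_deriveNid x 1)) _;
  rewrite mulrN1.
Qed.

Lemma is_derive_cosh x : is_derive x 1 cosh (sinh x).
Proof.
have dN := is_derive_expRN x; rewrite /cosh /sinh.
by apply: is_derive_eq; rewrite /GRing.scale /=; lra.
Qed.

Lemma is_derive_sinh x : is_derive x 1 sinh (cosh x).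
Proof.
have dN := is_derive_expRN x; rewrite /cosh /sinh.
by apply: is_derive_eq; rewrite /GRing.scale /=; lra.
Qed.

Lemma sinh0 : sinh 0 = 0.
Proof. by rewrite /sinh oppr0 subrr mul0r. Qed.

Lemma cosh0 : cosh 0 = 1.
Proof. by rewrite /cosh oppr0 expR0; lra. Qed.

Lemma sinhN x : sinh (- x) = - sinh x.
Proof. by rewrite /sinh opprK; lra. Qed.

Lemma coshN x : cosh (- x) = cosh x.
Proof. by rewrite /cosh opprK addrC. Qed.

Lemma cosh_ge1 x : 1 <= cosh x.
Proof. by have := expR_ge1Dx x; have := expR_ge1Dx (- x); rewrite /cosh; lra. Qed.

Lemma cosh_gt0 x : 0 < cosh x.
Proof. exact: lt_le_trans (cosh_ge1 x). Qed.

Lemma sinh_ge y : 0 <= y -> y <= sinh y.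
Proof.
move=> y0; rewrite -subr_ge0.
have := @ge0_is_derive_ge (fun z => sinh z - z) (fun z => cosh z - 1) _ _ y y0.
rewrite /= sinh0 subr0; apply => [x|x _].
  by have dS := is_derive_sinh x; apply: is_derive_eq.
by rewrite subr_ge0 cosh_ge1.
Qed.

Lemma sinh_le y : 0 <= y -> sinh y <= y * cosh y.
Proof.
move=> y0; rewrite -subr_ge0.
have := @ge0_is_derive_ge (fun z => z * cosh z - sinh z) (fun z => z * sinh z) _ _ y y0.
rewrite /= sinh0 mul0r subr0; apply => [x|x x0].
  have dS := is_derive_sinh x; have dC := is_derive_cosh x.
  by apply: is_derive_eq; rewrite /GRing.scale /=; lra.
by rewrite mulr_ge0// (le_trans x0)// sinh_ge.
Qed.

Lemma cosh_ge y : 1 + y ^+ 2 / 2 <= cosh y.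
Proof.
wlog y0 : y / 0 <= y.
  move=> H; case: (leP 0 y) => [/H//|y0].
  by rewrite -sqrrN -coshN H// oppr_ge0 ltW.
rewrite -subr_ge0.
have := @ge0_is_derive_ge (fun z => cosh z - (1 + z ^+ 2 / 2)) (fun z => sinh z - z) _ _ y y0.
rewrite /= cosh0 expr0n/= mul0r addr0 subrr; apply => [x|x x0];
  last by rewrite subr_ge0 sinh_ge.
have dC := is_derive_cosh x.
by apply: is_derive_eq; rewrite /GRing.scale /=; lra.
Qed.

(** The mean of exp (spin * y - y^2 / 2) over a fair spin, hence the normaliser of a tilted spin. *)
Definition cosh_gauss y : R := cosh y * expR (- (y ^+ 2 / 2)).

Lemma cosh_gauss_ge0 y : 0 <= cosh_gauss y.
Proof. by rewrite mulr_ge0 ?expR_ge0// ltW// cosh_gt0. Qed.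

Lemma is_derive_gauss x :
  is_derive x 1 (fun z => expR (- (z ^+ 2 / 2))) (- x * expR (- (x ^+ 2 / 2))).
Proof.
have d1 : is_derive x 1 (fun z : R => - (z ^+ 2 / 2)) (- x).
  by apply: is_derive_eq; rewrite /GRing.scale /=; lra.
by apply: is_derive_eq (is_derive1_comp (is_derive_expR _) d1) _; rewrite mulrC.
Qed.

Lemma cosh_gauss0 : cosh_gauss 0 = 1.
Proof. by rewrite /cosh_gauss cosh0 expr0n/= mul0r oppr0 expR0 mulr1. Qed.

(** This is cosh y <= exp (y^2 / 2): the derivative of [cosh_gauss] has the sign of sinh y - y cosh
    y, which is at most 0 for y >= 0. *)
Lemma cosh_gauss_le1 y : cosh_gauss y <= 1.
Proof.
wlog y0 : y / 0 <= y.
  move=> H; case: (leP 0 y) => [/H//|y0].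
  by rewrite /cosh_gauss -coshN -sqrrN H// oppr_ge0 ltW.
have := @ge0_is_derive_ge (fun z => - cosh_gauss z)
  (fun z => (z * cosh z - sinh z) * expR (- (z ^+ 2 / 2))) _ _ y y0.
rewrite /= cosh_gauss0 lerN2; apply => [x|x x0].
  have dS := is_derive_gauss x; have dC := is_derive_cosh x.
  by apply: is_derive_eq; rewrite /GRing.scale /=; lra.
by rewrite mulr_ge0 ?expR_ge0// subr_ge0 sinh_le.
Qed.

(** The terms of order y^2 cancel: the lower bounds 1 + y^2/2 of cosh and 1 - y^2/2 of the
    exponential multiply to 1 - y^4/4. *)
Lemma cosh_gauss_ge y : 1 - cosh_gauss y <= y ^+ 4.
Proof.
have e := expR_ge1Dx (- (y ^+ 2 / 2)); have c := cosh_ge y.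
have e0 := expR_ge0 (- (y ^+ 2 / 2)).
have y2 : 0 <= y ^+ 2 by exact: sqr_ge0.
have y4 : y ^+ 4 = y ^+ 2 * y ^+ 2 by lra.
rewrite y4 /cosh_gauss.
have : (1 + y ^+ 2 / 2) * expR (- (y ^+ 2 / 2)) <= cosh y * expR (- (y ^+ 2 / 2)).
  by rewrite ler_wpM2r.
have : (1 + y ^+ 2 / 2) * (1 - y ^+ 2 / 2) <= (1 + y ^+ 2 / 2) * expR (- (y ^+ 2 / 2)).
  by rewrite ler_wpM2l// addr_ge0// divr_ge0.
have := mulr_ge0 y2 y2; lra.
Qed.

Lemma tanhN y : tanh (- y) = - tanh y.
Proof. by rewrite /tanh sinhN coshN mulNr. Qed.

(** For the lower bound, cosh y (1 - y^2/2) <= [cosh_gauss y] <= 1, and y <= sinh y. *)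
Lemma tanh_bounds y : 0 <= y -> y - y ^+ 3 / 2 <= tanh y <= y.
Proof.
move=> y0; have c0 := cosh_gt0 y; rewrite /tanh ler_pdivrMr// sinh_le// andbT.
rewrite ler_pdivlMr//; apply: le_trans (sinh_ge y0).
have := cosh_gauss_le1 y; rewrite /cosh_gauss => cg.
have := expR_ge1Dx (- (y ^+ 2 / 2)) => e.
have -> : (y - y ^+ 3 / 2) * cosh y = y * (cosh y * (1 - y ^+ 2 / 2)) by lra.
rewrite ler_piMr//; apply: le_trans cg; rewrite ler_wpM2l//; exact: ltW.
Qed.

Lemma tanh_sqr_le y : tanh y ^+ 2 <= y ^+ 2.
Proof.
wlog y0 : y / 0 <= y.
  move=> H; case: (leP 0 y) => [/H//|y0].
  by rewrite -(sqrrN y) -(sqrrN (tanh y)) -tanhN H// oppr_ge0 ltW.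
have /andP[_ ty] := tanh_bounds y0.
apply: lerXn2r; rewrite ?nnegrE//.
exact: divr_ge0 (le_trans y0 (sinh_ge y0)) (ltW (cosh_gt0 y)).
Qed.

Lemma tanh_dist y : (y - tanh y) ^+ 2 <= y ^+ 6 / 4.
Proof.
wlog y0 : y / 0 <= y.
  move=> H; case: (leP 0 y) => [/H//|y0].
  rewrite (_ : y ^+ 6 = (- y) ^+ 6); last by lra.
  rewrite (_ : (y - tanh y) ^+ 2 = (- y - tanh (- y)) ^+ 2).
    by rewrite H// oppr_ge0 ltW.
  by rewrite tanhN; lra.
have /andP[t1 t2] := tanh_bounds y0.
rewrite (_ : y ^+ 6 / 4 = (y ^+ 3 / 2) ^+ 2); last by lra.
apply: lerXn2r; rewrite ?nnegrE ?subr_ge0//; last by lra.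
by rewrite divr_ge0// exprn_ge0.
Qed.

(** Every function of one spin is affine in it. This puts an exponential weight in the form of
    [lin_prod], so that both laws are compared factor by factor. *)
Lemma exp_spin (b : bool) y :
  expR (spin b * y - y ^+ 2 / 2) = cosh_gauss y * (1 + spin b * tanh y).
Proof.
rewrite expRD /cosh_gauss [RHS]mulrAC; congr (_ * _).
rewrite mulrDr mulr1 mulrCA /tanh [cosh y * (_ / _)]mulrC divfK ?lt0r_neq0 ?cosh_gt0//.
by rewrite /cosh /sinh /spin; case: b; rewrite ?mul1r ?mulN1r; lra.
Qed.

Lemma prod_exp_spin d (S : {set 'I_d}) y (x : d.-tuple bool) :
  expR ((\sum_(j in S) spin (tnth x j)) * y - #|S|%:R * y ^+ 2 / 2) =
  cosh_gauss y ^+ #|S| * lin_prod S (tanh y) x.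
Proof.
rewrite /lin_prod -prodr_const -big_split /=.
under [RHS]eq_bigr do rewrite -exp_spin.
rewrite -expR_sum big_split /= -mulr_suml sumr_const -mulr_natl.
by congr (expR (_ + _)); lra.
Qed.

End hyperbolic.

(** * Gaussian means *)

Section gaussian_mean.
Context {R : realType}.
Local Open Scope classical_set_scope.
Notation mu := (@lebesgue_measure R).
Implicit Types f : R -> R.

Definition gmean f : R := \int[mu]_g (normal_pdf 0 1 g * f g).

Definition gintegrable f :=
  mu.-integrable setT (EFin \o (fun g => normal_pdf 0 1 g * f g)).

Lemma eq_gmean f1 f2 : f1 =1 f2 -> gmean f1 = gmean f2.
Proof. by move=> ff; congr Rintegral; apply/funext => g; rewrite ff. Qed.

Lemma gintegrable_bounded f C : measurable_fun setT f ->
  (forall g, `|f g| <= C) -> gintegrable f.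
Proof.
move=> mf fC.
apply: (@le_integrable _ _ _ mu setT measurableT _ (fun g =>
  C%:E * (normal_pdf 0 1 g)%:E)%E) => //.
- by apply/measurable_EFinP/measurable_funM => //; exact: measurable_normal_pdf.
- move=> g _; rewrite /= lee_fin normrM.
  rewrite ger0_norm ?normal_pdf_ge0// mulrC.
  by rewrite (le_trans _ (ler_norm _))// ler_wpM2r ?normal_pdf_ge0.
- by apply: integrableZl => //; exact: integrable_normal_pdf.
Qed.

Lemma gintegrableD f1 f2 : gintegrable f1 -> gintegrable f2 ->
  gintegrable (fun g => f1 g + f2 g).
Proof.
move=> i1 i2; have := integrableD measurableT i1 i2.
by apply: eq_integrable => // g _; rewrite /= -EFinD mulrDr.
Qed.

Lemma gintegrableZ c f : gintegrable f -> gintegrable (fun g => c * f g).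
Proof.
move=> i1; have := integrableZl measurableT c i1.
by apply: eq_integrable => // g _; rewrite /= -EFinM mulrCA.
Qed.

Lemma gmeanD f1 f2 : gintegrable f1 -> gintegrable f2 ->
  gmean (fun g => f1 g + f2 g) = gmean f1 + gmean f2.
Proof.
by move=> i1 i2; rewrite /gmean -RintegralD//; apply: eq_Rintegral => g _; rewrite mulrDr.
Qed.

Lemma gmeanZ c f : gintegrable f -> gmean (fun g => c * f g) = c * gmean f.
Proof.
by move=> i1; rewrite /gmean -RintegralZl//; apply: eq_Rintegral => g _; rewrite mulrCA.
Qed.

Lemma le_gmean f1 f2 : gintegrable f1 -> gintegrable f2 ->
  (forall g, f1 g <= f2 g) -> gmean f1 <= gmean f2.
Proof.
move=> i1 i2 f12; apply: le_Rintegral => // g _.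
by rewrite ler_wpM2l ?normal_pdf_ge0.
Qed.

Lemma gintegrable_cst c : gintegrable (fun=> c).
Proof. exact: (@gintegrable_bounded _ `|c|). Qed.

Lemma gmean_cst c : gmean (fun=> c) = c.
Proof.
rewrite /gmean RintegralZr//; last exact: integrable_normal_pdf.
by rewrite /Rintegral integral_normal_pdf /= mul1r.
Qed.

Lemma gmean_sum (I : finType) (F : I -> R -> R) : (forall i, gintegrable (F i)) ->
  gintegrable (fun g => \sum_i F i g) /\
  gmean (fun g => \sum_i F i g) = \sum_i gmean (F i).
Proof.
move=> iF; elim: (index_enum I) => [|i r [IH1 IH2]].
  rewrite big_nil; under eq_fun do rewrite big_nil.
  by split; [exact: gintegrable_cst|exact: gmean_cst].
rewrite big_cons; under eq_fun do rewrite big_cons.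
by split; [exact: gintegrableD|rewrite gmeanD// IH2].
Qed.

Lemma gmean_sqr_le f : gintegrable f -> gintegrable (fun g => f g ^+ 2) ->
  gmean f ^+ 2 <= gmean (fun g => f g ^+ 2).
Proof.
move=> i1 i2; set c := gmean f.
have : gmean (fun g => (2 * c) * f g) <= gmean (fun g => f g ^+ 2 + c ^+ 2).
  apply: le_gmean; [exact: gintegrableZ| |].
    by apply: gintegrableD => //; exact: gintegrable_cst.
  by move=> g; rewrite -subr_ge0; have := sqr_ge0 (f g - c); rewrite sqrrB; lra.
rewrite gmeanZ// gmeanD ?gmean_cst//; last exact: gintegrable_cst.
by rewrite -/c; lra.
Qed.

(* Completing the square turns the tilted standard normal density into a
   multiple of the normal density with mean c / (1 + a) and variance 1 / (1 + a). *)
Lemma normal_pdf_tilt (a c g : R) : -1 < a ->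
  normal_pdf 0 1 g * expR (c * g - a * g ^+ 2 / 2) =
  (Num.sqrt (1 + a))^-1 * expR (c ^+ 2 / (2 * (1 + a))) *
  normal_pdf (c / (1 + a)) (Num.sqrt (1 + a))^-1 g.
Proof.
move=> a1; have A0 : 0 < 1 + a by lra.
set A := 1 + a in A0 *; have aA : a = A - 1 by rewrite /A; lra.
have sA0 : 0 < Num.sqrt A by rewrite sqrtr_gt0.
have AV : A * A^-1 = 1 by rewrite mulfV// lt0r_neq0.
rewrite !normal_pdfE ?invr_neq0 ?lt0r_neq0// /normal_peak /normal_fun.
have -> : (Num.sqrt A)^-1 ^+ 2 = A^-1 by rewrite exprVn sqr_sqrtr// ltW.
have -> : Num.sqrt (A^-1 * pi *+ 2) = (Num.sqrt A)^-1 * Num.sqrt (1 ^+ 2 * pi *+ 2).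
  rewrite -mulrnAr sqrtrM ?invr_ge0 ?ltW// sqrtrV ?ltW//.
  by rewrite expr1n mul1r.
set S := Num.sqrt (1 ^+ 2 * pi *+ 2).
have -> : ((Num.sqrt A)^-1 * S)^-1 = Num.sqrt A * S^-1 by rewrite invfM invrK.
have -> : A^-1 *+ 2 = (A / 2)^-1 by rewrite invfM invrK mulr_natr.
have -> : c ^+ 2 / (2 * A) = c ^+ 2 * A^-1 / 2 by rewrite invfM; lra.
rewrite invrK; set X := expR (c ^+ 2 * _ / 2); set Y := expR (- (g - c / A) ^+ 2 * _).
have -> : (Num.sqrt A)^-1 * X * (Num.sqrt A * S^-1 * Y) =
    ((Num.sqrt A)^-1 * Num.sqrt A) * (S^-1 * (X * Y)) by lra.
rewrite mulVf ?lt0r_neq0// mul1r -[LHS]mulrA; congr (_ * _).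
rewrite /X /Y -!expRD; congr expR.
move: AV; set V := A^-1 => AV.
have -> : (1 ^+ 2 *+ 2 : R)^-1 = 2^-1 by rewrite expr1n.
have -> : - (g - c * V) ^+ 2 * (A / 2) =
    - (g ^+ 2 * A / 2) + g * c * (A * V) - c ^+ 2 * V * (A * V) / 2 by lra.
by rewrite AV aA; lra.
Qed.

Lemma gintegrable_tilt (a c : R) : -1 < a ->
  gintegrable (fun g => expR (c * g - a * g ^+ 2 / 2)).
Proof.
move=> a1; have := integrableZl measurableT
  ((Num.sqrt (1 + a))^-1 * expR (c ^+ 2 / (2 * (1 + a))))
  (integrable_normal_pdf (c / (1 + a)) (Num.sqrt (1 + a))^-1).
by apply: eq_integrable => // g _; rewrite /= -EFinM -normal_pdf_tilt.
Qed.

(** For a >= 0 this is the Hubbard-Stratonovich identity, used for the Ising weight and for the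
    spiked normal density. Negative a is allowed because a = -1/2 gives the mean of exp (g^2 / 4),
    which controls the moments of g. *)
Lemma gmean_tilt (a c : R) : -1 < a ->
  gmean (fun g => expR (c * g - a * g ^+ 2 / 2)) =
  (Num.sqrt (1 + a))^-1 * expR (c ^+ 2 / (2 * (1 + a))).
Proof.
move=> a1; rewrite /gmean.
rewrite (@eq_Rintegral _ _ _ mu setT (fun g =>
  ((Num.sqrt (1 + a))^-1 * expR (c ^+ 2 / (2 * (1 + a)))) *
   normal_pdf (c / (1 + a)) (Num.sqrt (1 + a))^-1 g)); last first.
  by move=> g _; rewrite normal_pdf_tilt.
rewrite RintegralZl//; last exact: integrable_normal_pdf.
by rewrite /Rintegral integral_normal_pdf /= mulr1.
Qed.

End gaussian_mean.

(** * Signs of a shifted normal variable *)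

Section gaussian_tail.
Context {R : realType}.
Local Open Scope classical_set_scope.
Notation mu := (@lebesgue_measure R).
Implicit Types m t : R.

Lemma normal_pdf_shift m t : normal_pdf m 1 t = normal_pdf 0 1 (t - m) :> R.
Proof. by rewrite !normal_pdfE// /normal_fun subr0. Qed.

Lemma normal_pdfN t : normal_pdf 0 1 (- t) = normal_pdf 0 1 t :> R.
Proof. by rewrite !normal_pdfE// /normal_fun !subr0 sqrrN. Qed.

Definition upper m : R := \int[mu]_(t in `[0, +oo[) normal_pdf m 1 t.

Lemma upperE m : (\int[mu]_(t in `[0%R, +oo[) (normal_pdf m 1 t)%:E = (upper m)%:E)%E.
Proof.
rewrite fineK//; apply: integrable_fin_num => //.
by apply: (integrableS measurableT) => //; exact: integrable_normal_pdf.
Qed.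

(** Moves the dependence on [m] from the integrand to the domain, from which monotonicity of [upper]
    and an integral formula for [sign_mean] can be read off. *)
Lemma upper_shift m :
  (\int[mu]_(t in `[(- m)%R, +oo[) (normal_pdf 0 1 t)%:E = (upper m)%:E)%E.
Proof.
have D : (fun x : R => x - m)^`() = cst 1.
  by apply/funext => z; rewrite derive1E deriveB// derive_id derive_cst subr0.
rewrite -upperE -[(- m)%R]sub0r.
rewrite (@increasing_ge0_integration_by_substitutiony _ (fun x => x - m) (normal_pdf 0 1)).
- by apply: eq_integral => t _; rewrite D !fctE /= mulr1 [in RHS]normal_pdf_shift.
- by move=> x y _ _; rewrite ltrD2r.
- by rewrite D => ? _; exact: cst_continuous.
- by rewrite D; exact: is_cvg_cst.
- by rewrite D; exact: is_cvg_cst.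
- split; first by move=> x _; apply: derivableB; [exact: derivable_id|exact: derivable_cst].
  by apply: cvg_at_right_filter; apply: (@cvgB _ R^o); [exact: cvg_id|exact: cvg_cst].
- exact: cvg_addrr.
- by apply: continuous_subspaceT; apply: continuous_normal_pdf.
- by move=> x _; exact: normal_pdf_ge0.
Qed.

Lemma lower_shift m :
  (\int[mu]_(t in `]-oo, 0%R[) (normal_pdf m 1 t)%:E = (upper (- m))%:E)%E.
Proof.
rewrite integral_itv_bndo_bndc; last first.
  apply/measurable_funTS/measurable_EFinP; exact: measurable_normal_pdf.
rewrite -[X in `]-oo, X]]oppr0 ge0_integration_by_substitutionNy.
- rewrite -upperE; apply: eq_integral => t _ /=.
  by rewrite (normal_pdf_shift m) (normal_pdf_shift (- m)) -normal_pdfN opprD opprK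
    addrC opprK addrC.
- by apply: continuous_subspaceT; apply: continuous_normal_pdf.
- by move=> x _; exact: normal_pdf_ge0.
Qed.

Definition sign_weight (b : bool) m : R := upper (if b then m else - m).

Lemma integral_sign_weight b m :
  (\int[mu]_t ((sgb t == b)%:R * normal_pdf m 1 t)%:E = (sign_weight b m)%:E)%E.
Proof.
rewrite /sign_weight; case: b.
  rewrite -upperE [RHS]integral_mkcond; apply: eq_integral => t _.
  rewrite patchE /sgb mem_setE in_itv /= andbT eqb_id.
  by case: ifP; rewrite ?mul1r ?mul0r.
rewrite -lower_shift [RHS]integral_mkcond; apply: eq_integral => t _.
rewrite patchE /sgb mem_setE in_itv /= eqbF_neg -ltNge.
by case: ifP; rewrite ?mul1r ?mul0r.
Qed.

Lemma upperD m : upper m + upper (- m) = 1.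
Proof.
apply: EFin_inj; rewrite EFinD -upperE -lower_shift -(integral_normal_pdf m 1).
rewrite -integral_setU_EFin//=; last 2 first.
  by apply/measurable_funTS; exact: measurable_normal_pdf.
  by apply/disj_setPS => t; rewrite /= !in_itv/= andbT => -[t0 /(le_lt_trans t0)];
    rewrite ltxx.
congr (integral _ _ _); apply/seteqP; split => // t _ /=.
by rewrite !in_itv/= andbT; case: (leP 0 t) => ?; [left|right].
Qed.

Lemma sign_weight_ge0 b m : 0 <= sign_weight b m.
Proof. by apply: Rintegral_ge0 => t _; exact: normal_pdf_ge0. Qed.

Lemma upper_le : {homo upper : m1 m2 / m1 <= m2}.
Proof.
move=> m1 m2 m12; rewrite -lee_fin -!upper_shift.
apply: ge0_subset_integral => //.
- by apply/measurable_funTS/measurable_EFinP; exact: measurable_normal_pdf.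
- by move=> t _; rewrite lee_fin normal_pdf_ge0.
- by move=> t /=; rewrite !in_itv/= !andbT; apply: le_trans; rewrite lerN2.
Qed.

Lemma measurable_upper : measurable_fun setT upper.
Proof. by apply: nondecreasing_measurable => //; exact: upper_le. Qed.

(** The mean sign of a normal variable with mean [m] and variance 1, that is erf (m / sqrt 2). *)
Definition sign_mean m : R := upper m - upper (- m).

Lemma sign_weightE b m : sign_weight b m = (1 + spin b * sign_mean m) / 2.
Proof.
have := upperD m; rewrite /sign_weight /sign_mean /spin.
by case: b; move: (upper m) (upper (- m)) => u v; lra.
Qed.

Lemma sign_meanN m : sign_mean (- m) = - sign_mean m.
Proof. by rewrite /sign_mean opprK opprB. Qed.

(** The derivative of [sign_mean] at 0, equal to sqrt (2 / pi). *)
Definition sign_slope : R := 2 * normal_peak 1.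

Lemma sign_slope_gt0 : 0 < sign_slope.
Proof. by rewrite mulr_gt0// normal_peak_gt0. Qed.

(** [sign_mean m] is the standard normal mass of [-m, m), where the density lies between its peak
    times 1 - m^2/2 and its peak. *)
Lemma sign_mean_bounds m : 0 <= m ->
  sign_slope * m * (1 - m ^+ 2 / 2) <= sign_mean m <= sign_slope * m.
Proof.
move=> m0.
have : (\int[mu]_(t in `[(- m)%R, +oo[) (normal_pdf 0 1 t)%:E =
    \int[mu]_(t in `[(- m)%R, m[) (normal_pdf 0 1 t)%:E +
    \int[mu]_(t in `[m, +oo[) (normal_pdf 0 1 t)%:E)%E.
  rewrite -integral_setU_EFin//=; last 2 first.
    by apply/measurable_funTS; exact: measurable_normal_pdf.
    by apply/disj_setPS => t; rewrite /= !in_itv/= andbT =>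
      -[/andP[_ tm] /(lt_le_trans tm)]; rewrite ltxx.
  congr (integral _ _ _); apply/seteqP; split => t /=; rewrite !in_itv/= !andbT.
    by move=> ->; case: (ltP t m); [left|right].
  by case=> [/andP[]//|]; apply: le_trans; lra.
rewrite upper_shift; have := upper_shift (- m); rewrite opprK => ->.
set I := (\int[mu]_(t in `[(- m)%R, m[) _)%E => E.
have IE : I = (sign_mean m)%:E.
  have fI : I \is a fin_num.
    apply: integrable_fin_num => //.
    by apply: (integrableS measurableT) => //; exact: integrable_normal_pdf.
  clearbody I; move: fI E; case: I => //= r _; rewrite -EFinD => -[Er].
  by rewrite /sign_mean Er addrK.
have muE c : (\int[mu]_(t in `[(- m)%R, m[) (cst c%:E t) = (c * (2 * m))%:E)%E.
  rewrite integral_cst//= lebesgue_measure_itv/= lte_fin.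
  case: ltP => mm; first by rewrite -EFinM; congr EFin; lra.
  by rewrite mule0 (_ : m = 0) ?mulr0//; lra.
have mpdf : measurable_fun `[(- m)%R, m[ (fun t => (normal_pdf 0 1 t : R)%:E).
  by apply/measurable_funTS/measurable_EFinP; exact: measurable_normal_pdf.
apply/andP; split.
  (* Comparing integrals of nonnegative functions needs a nonnegative minorant; otherwise the lower
     bound is at most 0 and holds trivially. *)
  have [m2|m2] := leP (1 - m ^+ 2 / 2) 0.
    apply: (@le_trans _ _ 0); first by rewrite mulr_ge0_le0// mulr_ge0// ltW// sign_slope_gt0.
    by rewrite -lee_fin -IE; apply: integral_ge0 => t _; rewrite lee_fin normal_pdf_ge0.
  rewrite -lee_fin -IE (_ : sign_slope * m * _ = normal_peak 1 * (1 - m ^+ 2 / 2) * (2 * m)).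
    rewrite -muE; apply: ge0_le_integral => //.
    - by move=> t _; rewrite lee_fin mulr_ge0 ?normal_peak_ge0// ltW.
    - move=> t; rewrite /= in_itv/= => /andP[tm1 tm2]; rewrite lee_fin normal_pdfE//.
      rewrite ler_wpM2l ?normal_peak_ge0// /normal_fun subr0 expr1n mulNr.
      rewrite (le_trans _ (expR_ge1Dx _))// lerD2l lerN2 ler_wpM2r ?invr_ge0//.
      rewrite -(real_normK (num_real t)) -[m in leRHS](ger0_norm m0).
      by apply: lerXn2r; rewrite ?nnegrE// (ger0_norm m0) ler_norml tm1 ltW.
  by rewrite /sign_slope; lra.
rewrite -lee_fin -IE (_ : sign_slope * m = normal_peak 1 * (2 * m)).
  rewrite -muE; apply: ge0_le_integral => //.
  - by move=> t _; rewrite lee_fin normal_pdf_ge0.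
  - by move=> t _; rewrite lee_fin normal_pdf_ub.
by rewrite /sign_slope; lra.
Qed.

Lemma sign_mean_sqr_le m : sign_mean m ^+ 2 <= (sign_slope * m) ^+ 2.
Proof.
wlog m0 : m / 0 <= m.
  move=> H; case: (leP 0 m) => [/H//|m0].
  rewrite -(sqrrN (sign_mean m)) -(sqrrN (_ * m)) -mulrN -sign_meanN H//.
  by rewrite oppr_ge0 ltW.
have /andP[_ h2] := sign_mean_bounds m0.
apply: lerXn2r; rewrite ?nnegrE//; last by rewrite mulr_ge0// ltW// sign_slope_gt0.
by rewrite /sign_mean subr_ge0; apply: upper_le; lra.
Qed.

(** The square of the cubic error c m^3 / 2, c being the slope, rewritten in y = c m, the variable
    that the sign law shares with [tanh]. *)
Lemma sign_mean_dist m :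
  (sign_mean m - sign_slope * m) ^+ 2 <=
  (sign_slope * m) ^+ 6 / (4 * sign_slope ^+ 4).
Proof.
set c := sign_slope; have c0 : 0 < c := sign_slope_gt0.
have cV : c ^+ 4 * (c ^+ 4)^-1 = 1 by rewrite mulfV// expf_neq0// lt0r_neq0.
have -> : (c * m) ^+ 6 / (4 * c ^+ 4) = (c * m ^+ 3 / 2) ^+ 2.
  rewrite invfM; move: cV; set V := (c ^+ 4)^-1 => cV.
  rewrite (_ : (c * m) ^+ 6 * (4^-1 * V) = c ^+ 2 * m ^+ 6 / 4 * (c ^+ 4 * V)); last by lra.
  by rewrite cV; lra.
wlog m0 : m / 0 <= m.
  move=> H; case: (leP 0 m) => [/H//|m0].
  have := H (- m); rewrite sign_meanN oppr_ge0 => /(_ (ltW m0)).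
  rewrite [X in X <= _ -> _](_ : _ = (sign_mean m - c * m) ^+ 2); last by lra.
  by rewrite [X in _ <= X -> _](_ : _ = (c * m ^+ 3 / 2) ^+ 2)//; lra.
have /andP[h1 h2] := sign_mean_bounds m0; rewrite -sqrrN opprB.
have e : 0 <= c * m ^+ 3 / 2 by rewrite divr_ge0// mulr_ge0// ?exprn_ge0// ltW.
apply: lerXn2r; rewrite ?nnegrE// -/c in h1 h2 *; first by rewrite subr_ge0.
by lra.
Qed.

End gaussian_tail.

(** * Distance between the sign law and the clique Ising law *)

Section spiked_signs.
Context {R : realType}.
Implicit Types (b g : R).

(** Density of the signs with respect to the uniform law. Dividing by [sign_slope] makes the
    conditional mean b g to first order. *)
Definition spiked_density d (S : {set 'I_d}) b (x : d.-tuple bool) : R :=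
  gmean (fun g => lin_prod S (sign_mean (b / sign_slope * g)) x).

(** The Ising weight of the clique as a mixture of products; its mean under the uniform law need not
    be 1. *)
Definition gauss_density d (S : {set 'I_d}) b (x : d.-tuple bool) : R :=
  gmean (fun g => cosh_gauss (b * g) ^+ #|S| * lin_prod S (tanh (b * g)) x).

Lemma sign_mean_le1 m : `|sign_mean m : R| <= 1.
Proof.
have := sign_weight_ge0 true m; have := sign_weight_ge0 false m.
rewrite !sign_weightE /spin => h1 h2; rewrite ler_norml.
by move: (sign_mean m) h1 h2 => u h1 h2; apply/andP; split; lra.
Qed.

Lemma tanh_le1 y : `|tanh y : R| <= 1.
Proof.
rewrite /tanh normrM normfV (ger0_norm (ltW (cosh_gt0 y))) ler_pdivrMr ?cosh_gt0// mul1r.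
have := expR_ge0 y; have := expR_ge0 (- y); rewrite ler_norml /sinh /cosh => h1 h2.
by apply/andP; split; lra.
Qed.

Lemma lin_prod_bounds d (S : {set 'I_d}) (h : R) x : `|h| <= 1 ->
  0 <= lin_prod S h x <= 2 ^+ #|S|.
Proof.
move=> h1; have sh j : 0 <= 1 + spin (tnth x j) * h <= 2.
  by move: h1; rewrite ler_norml /spin => /andP[? ?]; case: (tnth x j); apply/andP; split; lra.
rewrite prodr_ge0 => [|j _]; last by case/andP: (sh j).
by rewrite /lin_prod -prodr_const; apply: ler_prod => j _; exact: sh.
Qed.

Lemma measurable_lin_prod d (S : {set 'I_d}) (h : R -> R) x :
  measurable_fun setT h -> measurable_fun setT (fun g => lin_prod S (h g) x).
Proof.
move=> mh; rewrite /lin_prod; under eq_fun do rewrite big_mkcond.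
apply: measurable_prod => j _; case: (j \in S) => //.
by apply: measurable_funD => //; apply: measurable_funM.
Qed.

Lemma measurable_sign_mean : measurable_fun setT (@sign_mean R).
Proof.
apply: measurable_funB; first exact: measurable_upper.
by apply: measurableT_comp => //; exact: measurable_upper.
Qed.

Lemma gintegrable_lin_prod d (S : {set 'I_d}) (a : R) x :
  gintegrable (fun g => lin_prod S (sign_mean (a * g)) x).
Proof.
apply: (@gintegrable_bounded _ _ (2 ^+ #|S|)).
  apply: measurable_lin_prod; apply: (measurableT_comp measurable_sign_mean).
  exact: measurable_funM.
move=> g; have /andP[l0 l1] := lin_prod_bounds S x (sign_mean_le1 (a * g)).
by rewrite ger0_norm.
Qed.

Lemma measurable_cosh_gauss_pow n : measurable_fun setT (fun y : R => cosh_gauss y ^+ n).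
Proof.
apply: measurable_funX; apply: continuous_measurable_fun => y.
apply: differentiable_continuous; apply/derivable1_diffP.
have dS := is_derive_gauss y; have dC := is_derive_cosh y.
by apply: derivableM.
Qed.

Lemma measurable_tanh : measurable_fun setT (@tanh R).
Proof.
apply: continuous_measurable_fun => y.
apply: differentiable_continuous; apply/derivable1_diffP.
have dS := is_derive_sinh y; have dC := is_derive_cosh y.
apply: derivableM => //; apply: derivableV => //; exact: lt0r_neq0 (cosh_gt0 y).
Qed.

(** The quadratic term of [prod_exp_spin] becomes the tilt parameter s b^2. Integrating g out leaves
    the exponential of a squared spin sum, and this dictates the relation between theta and b. *)
Lemma gauss_densityE d (S : {set 'I_d}) b x :
  gauss_density S b x =
  (Num.sqrt (1 + #|S|%:R * b ^+ 2))^-1 *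
  expR (b ^+ 2 / (2 * (1 + #|S|%:R * b ^+ 2)) * (\sum_(j in S) spin (tnth x j)) ^+ 2).
Proof.
set M := \sum_(j in S) _.
have a1 : -1 < #|S|%:R * b ^+ 2 by rewrite (lt_le_trans (ltrN10 _))// mulr_ge0// sqr_ge0.
rewrite (_ : _ * M ^+ 2 = (M * b) ^+ 2 / (2 * (1 + #|S|%:R * b ^+ 2))); last first.
  by set V := _^-1; lra.
rewrite -gmean_tilt//.
apply: eq_gmean => g; rewrite -prod_exp_spin -/M; congr expR; lra.
Qed.

Lemma expr_le_expR (u : R) n : 0 <= u -> u ^+ n.+1 <= n.+1`!%:R * expR u.
Proof.
move=> u0; have := expR_ge1Dxn n u0 => h.
have f0 : 0 < n.+1`!%:R :> R by rewrite ltr0n fact_gt0.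
rewrite -ler_pdivrMl// mulrC; apply: le_trans h; lra.
Qed.

(** The two terms of [c] come from the cubic errors of [sign_mean] and [tanh]. The numbers 8^3 * 3!
    and 8^4 * 4! bound g^6 and g^8 by multiples of exp (g^2 / 8), and sqrt 2 is the mean of exp (g^2
    / 4). *)
Definition dist_const : R :=
  let c := 2 * ((4 * sign_slope ^+ 4)^-1 + 4^-1) in
  (2 * c * (8 ^+ 3 * 6) + 2 * (8 ^+ 4 * 24)) * Num.sqrt 2.

Lemma dist_const_ge0 : 0 <= dist_const.
Proof.
rewrite /dist_const mulr_ge0 ?sqrtr_ge0//.
have : 0 <= (4 * sign_slope ^+ 4 : R)^-1.
  by rewrite invr_ge0 mulr_ge0// exprn_ge0// ltW// sign_slope_gt0.
by move: (_^-1) => u; lra.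
Qed.

(* The L2 distance between the law of the signs and the Ising law is of order
   b ^+ 2 although s * b ^+ 2 is only bounded. *)
Lemma spiked_gauss_dist d (S : {set 'I_d}) b : #|S|%:R * b ^+ 2 <= 16^-1 ->
  umean (fun x => (spiked_density S b x - gauss_density S b x) ^+ 2) <=
  dist_const * b ^+ 4.
Proof.
set s : R := #|S|%:R => sb.
set c : R := 2 * ((4 * sign_slope ^+ 4)^-1 + 4^-1).
have c0 : 0 <= c.
  rewrite mulr_ge0// addr_ge0// invr_ge0 mulr_ge0// exprn_ge0//.
  exact: ltW sign_slope_gt0.
pose A (x : d.-tuple bool) g := lin_prod S (sign_mean (b / sign_slope * g)) x.
pose B (x : d.-tuple bool) g := cosh_gauss (b * g) ^+ #|S| * lin_prod S (tanh (b * g)) x.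
have mA x : measurable_fun setT (A x).
  apply: measurable_lin_prod; apply: measurableT_comp; first exact: measurable_sign_mean.
  exact: measurable_funM.
have mB x : measurable_fun setT (B x).
  apply: measurable_funM.
    by apply: (@measurableT_comp _ _ _ _ _ _ (fun y : R => cosh_gauss y ^+ #|S|));
      [exact: measurable_cosh_gauss_pow|exact: measurable_funM].
  apply: measurable_lin_prod; apply: measurableT_comp; first exact: measurable_tanh.
  exact: measurable_funM.
have bA x g : 0 <= A x g <= 2 ^+ #|S| by apply: lin_prod_bounds; exact: sign_mean_le1.
have bB x g : 0 <= B x g <= 2 ^+ #|S|.
  have /andP[l1 l2] := lin_prod_bounds S x (tanh_le1 (b * g)).
  have r0 := cosh_gauss_ge0 (b * g); have r1 := cosh_gauss_le1 (b * g).
  rewrite mulr_ge0 ?exprn_ge0//= (le_trans _ l2)// ler_piMl//.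
  by rewrite exprn_ile1.
have bD x g : `|A x g - B x g| <= 2 ^+ #|S|.
  by move: (bA x g) (bB x g) => /andP[? ?] /andP[? ?]; rewrite ler_norml; apply/andP;
    split; lra.
have iA x : gintegrable (A x).
  apply: (@gintegrable_bounded _ _ (2 ^+ #|S|) (mA x)) => g.
  by case/andP: (bA x g) => ? ?; rewrite ger0_norm.
have iB x : gintegrable (B x).
  apply: (@gintegrable_bounded _ _ (2 ^+ #|S|) (mB x)) => g.
  by case/andP: (bB x g) => ? ?; rewrite ger0_norm.
have iD2 x : gintegrable (fun g => (A x g - B x g) ^+ 2).
  apply: (@gintegrable_bounded _ _ ((2 ^+ #|S|) ^+ 2)).
    by apply: measurable_funX; exact: measurable_funB.
  by move=> g; rewrite normrX; apply: lerXn2r; rewrite ?nnegrE.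
have dE x : spiked_density S b x - gauss_density S b x = gmean (fun g => A x g - B x g).
  rewrite (@eq_gmean _ _ (fun g => A x g + (-1) * B x g)); last first.
    by move=> g; rewrite mulN1r.
  by rewrite gmeanD ?gmeanZ ?mulN1r//; exact: gintegrableZ.
have [iS ES] := gmean_sum iD2.
(* Jensen's inequality brings the square inside the mean over g, so that it remains to compare the
   laws conditional on g. *)
apply: (@le_trans _ _ (gmean (fun g => umean (fun x => (A x g - B x g) ^+ 2)))).
  rewrite (@eq_gmean _ _ (fun g => (2 ^+ d)^-1 * \sum_x (A x g - B x g) ^+ 2)); last first.
    by move=> g; rewrite /umean mulrC.
  rewrite gmeanZ// ES mulrC /umean ler_wpM2r ?invr_ge0 ?exprn_ge0//.
  apply: ler_sum => x _; rewrite dE; apply: gmean_sqr_le (iD2 x).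
  rewrite (_ : (fun _ => _) = (fun g => A x g + (-1) * B x g)); last first.
    by apply/funext => g; rewrite mulN1r.
  by apply: gintegrableD => //; exact: gintegrableZ.
have b40 : 0 <= b ^+ 4 by rewrite exprn_even_ge0.
have [k3 k3E] : exists k3 : R, k3 = 8 ^+ 3 * 6 by eexists.
have [k4 k4E] : exists k4 : R, k4 = 8 ^+ 4 * 24 by eexists.
rewrite /dist_const -/c -k3E -k4E.
have k30 : 0 <= k3 by lra.
have k40 : 0 <= k4 by lra.
set K := (2 * c * k3 + 2 * k4) * b ^+ 4.
have K0 : 0 <= K.
  by apply: mulr_ge0 => //; apply: addr_ge0; apply: mulr_ge0 => //; exact: mulr_ge0.
have tilt1 : -1 < - 2^-1 :> R by lra.
have gi := gintegrable_tilt 0 tilt1.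
(* The majorant is K exp (g^2 / 4): one factor exp (g^2 / 8) dominates the powers of g, the other
   dominates exp (2 s b^2 g^2), which is where 1/16 is needed. *)
apply: (@le_trans _ _ (gmean (fun g => K * expR (0 * g - (- 2^-1) * g ^+ 2 / 2)))); last first.
  rewrite gmeanZ// gmean_tilt// expr0n /= mul0r expR0 mulr1 /K.
  rewrite -sqrtrV; last by lra.
  rewrite (_ : (1 - 2^-1)^-1 = 2 :> R); first by lra.
  by rewrite (_ : 1 - 2^-1 = 2^-1) ?invrK//; lra.
apply: le_gmean; last 2 first.
- exact: gintegrableZ.
- move=> g; set y := b * g.
  apply: le_trans (@umean_exp_dist _ d S _ (tanh y) (cosh_gauss y) y c _ _ _ _ _) _.
  + by have := sign_mean_sqr_le (b / sign_slope * g);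
    rewrite mulrA mulrCA divff ?mulr1 // lt0r_neq0 ?sign_slope_gt0.
  + exact: tanh_sqr_le.
  + set h := sign_mean _.
    have := sign_mean_dist (b / sign_slope * g); rewrite mulrA mulrCA divff ?mulr1; last first.
      by rewrite lt0r_neq0 ?sign_slope_gt0.
    rewrite -/y -/h => d1; have d2 := tanh_dist y.
    (* Both means are close to y, and (h - tanh y)^2 <= 2 (h - y)^2 + 2 (y - tanh y)^2. *)
    rewrite /c; have := sqr_ge0 ((h - y) - (y - tanh y)).
    set V := (4 * _)^-1 in d1 *; lra.
  + by rewrite cosh_gauss_ge0 cosh_gauss_le1.
  + exact: cosh_gauss_ge.
  rewrite -/s.
  have u0 : 0 <= g ^+ 2 / 8 by rewrite divr_ge0// sqr_ge0.
  have e3 := expr_le_expR 2 u0; have e4 := expr_le_expR 3 u0.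
  set E := expR (g ^+ 2 / 8) in e3 e4.
  have E1 : 1 <= E by rewrite (le_trans _ (expR_ge1Dx _))// lerDl.
  have b20 : 0 <= b ^+ 2 := sqr_ge0 b.
  have sb0 : 0 <= s * b ^+ 2 by rewrite mulr_ge0// /s.
  have -> : expR (0 * g - - 2^-1 * g ^+ 2 / 2) = E * E.
    by rewrite /E -expRD; congr expR; lra.
  have EE : expR (2 * (s * y ^+ 2)) <= E.
    rewrite ler_expR /y exprMn.
    rewrite (_ : 2 * (s * (b ^+ 2 * g ^+ 2)) = (s * b ^+ 2) * (2 * g ^+ 2)); last by lra.
    apply: le_trans (ler_wpM2r _ sb) _; last by lra.
    by rewrite mulr_ge0// sqr_ge0.
  rewrite [leRHS]mulrA; apply: ler_pM; rewrite ?expR_ge0//.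
    have y6 : 0 <= y ^+ 6 by rewrite exprn_even_ge0.
    have y8 : 0 <= y ^+ 8 by rewrite exprn_even_ge0.
    have s0 : 0 <= s by rewrite /s.
    apply: addr_ge0; first by rewrite (mulr_ge0 (mulr_ge0 (mulr_ge0 _ c0) s0) y6).
    by rewrite (mulr_ge0 (mulr_ge0 _ (sqr_ge0 s)) y8).
  have g6 : g ^+ 6 <= k3 * E.
    have -> : g ^+ 6 = 8 ^+ 3 * (g ^+ 2 / 8) ^+ 3 by lra.
    by rewrite k3E -[leRHS]mulrA; apply: ler_wpM2l e3; lra.
  have g8 : g ^+ 8 <= k4 * E.
    have -> : g ^+ 8 = 8 ^+ 4 * (g ^+ 2 / 8) ^+ 4 by lra.
    by rewrite k4E -[leRHS]mulrA; apply: ler_wpM2l e4; lra.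
  have g60 : 0 <= g ^+ 6 by rewrite exprn_even_ge0.
  have g80 : 0 <= g ^+ 8 by rewrite exprn_even_ge0.
  have sb1 : s * b ^+ 2 <= 1 by lra.
  (* Here s disappears: s b^6 = b^4 (s b^2), and likewise s^2 b^8 = b^4 (s b^2)^2 below. *)
  have t6 : s * y ^+ 6 <= b ^+ 4 * (k3 * E).
    rewrite /y (_ : s * (b * g) ^+ 6 = b ^+ 4 * ((s * b ^+ 2) * g ^+ 6)); last by lra.
    by rewrite ler_wpM2l// (le_trans _ g6)// ler_piMl.
  have t8 : s ^+ 2 * y ^+ 8 <= b ^+ 4 * (k4 * E).
    rewrite /y (_ : s ^+ 2 * (b * g) ^+ 8 = b ^+ 4 * ((s * b ^+ 2) ^+ 2 * g ^+ 8));
      last by lra.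
    by rewrite ler_wpM2l// (le_trans _ g8)// ler_piMl// exprn_ile1.
  rewrite (_ : K * E = 2 * c * (b ^+ 4 * (k3 * E)) + 2 * (b ^+ 4 * (k4 * E))).
    rewrite -(mulrA (2 * c)) -(mulrA 2 (s ^+ 2)); apply: lerD.
      by apply: ler_wpM2l t6; exact: mulr_ge0.
    exact: ler_wpM2l t8.
  by rewrite /K; clearbody c; lra.
rewrite (_ : (fun _ => _) = (fun g => (2 ^+ d)^-1 * \sum_x (A x g - B x g) ^+ 2)).
  exact: gintegrableZ.
by apply/funext => g; rewrite /umean mulrC.
Qed.

End spiked_signs.

(** * Powers of measures *)

Section power_measure.
Local Open Scope classical_set_scope.
Local Open Scope ereal_scope.

Section cons_measure.
Context {d : measure_display} {T : measurableType d} {R : realType} {n : nat}.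
Variables (m1 : {sigma_finite_measure set T -> \bar R})
  (m2 : {sigma_finite_measure set (n.-tuple T) -> \bar R}).

Definition tcons (p : T * n.-tuple T) : n.+1.-tuple T := [tuple of p.1 :: p.2].

Lemma measurable_tcons : measurable_fun setT tcons.
Proof. exact: measurable_cons. Qed.

Let cons_measure := pushforward (m1 \x m2) tcons.

Let cons_measure0 : cons_measure set0 = 0.
Proof. by rewrite /cons_measure /pushforward preimage_set0 measure0. Qed.

Let cons_measure_ge0 A : 0 <= cons_measure A.
Proof. by rewrite /cons_measure /pushforward; exact: measure_ge0. Qed.

Let cons_measure_sigma_additive : semi_sigma_additive cons_measure.
Proof.
move=> F mF tF mUF.
exact: (@measure_semi_sigma_additive _ _ _
  (measure_function_pushforward__canonical__measure_function_Measure (m1 \x m2)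
    measurable_tcons)).
Qed.

Let cons_measure_sigma_finite : sigma_finite setT cons_measure.
Proof.
have /sigma_finiteP[F [TF ndF Foo]] := sigma_finiteT m1.
have /sigma_finiteP[G [TG ndG Goo]] := sigma_finiteT m2.
pose u (z : n.+1.-tuple T) := (thead z, [tuple of behead z]).
have mu : measurable_fun setT u.
  by apply: measurable_fun_pair; [exact: measurable_tnth|exact: measurable_behead].
exists (fun k => u @^-1` (F k `*` G k)).
  apply/seteqP; split=> // z _.
  have [i _ Fi] : (\bigcup_i F i) (thead z) by rewrite -TF.
  have [j _ Gj] : (\bigcup_i G i) [tuple of behead z] by rewrite -TG.
  (* Both exhaustions are increasing, so one index serves head and tail. *)
  exists (maxn i j) => //; split => /=.
    by apply: (subsetPset _ _ (ndF _ _ (leq_maxl i j))) Fi.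
  by apply: (subsetPset _ _ (ndG _ _ (leq_maxr i j))) Gj.
move=> k; have [mF Fk] := Foo k; have [mG Gk] := Goo k; split.
  by rewrite -[X in measurable X]setTI; apply: mu => //; exact: measurableX.
rewrite /cons_measure /pushforward (_ : _ @^-1` _ = F k `*` G k).
  by rewrite product_measure1E// lte_mul_pinfty// ge0_fin_numE.
have uK p : u (tcons p) = p.
  case: p => x t; rewrite /u /tcons /= theadE; congr pair; exact/val_inj.
by rewrite -comp_preimage (_ : u \o tcons = id) ?preimage_id//; exact/funext.
Qed.

(** [power_measure] is a bare set function, whereas Tonelli requires a sigma-finite measure. The
    structure is therefore provided by a measure equal to it as a function. *)
Lemma cons_measureP : exists M : {sigma_finite_measure set (n.+1.-tuple T) -> \bar R},
  M = cons_measure :> (set _ -> _).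
Proof.
pose H1 := isMeasure.Build _ _ _ cons_measure cons_measure0 cons_measure_ge0
  cons_measure_sigma_additive.
pose M1 := HB.pack_for (Measure.type (n.+1.-tuple T) R) cons_measure H1.
pose H2 := Measure_isSigmaFinite.Build _ _ _ (Measure.sort M1) cons_measure_sigma_finite.
by exists (HB.pack_for (SigmaFiniteMeasure.type (n.+1.-tuple T) R) (Measure.sort M1) H2).
Qed.

End cons_measure.

Context {d : measure_display} {T : measurableType d} {R : realType}.

Lemma power_measureP (mu : {sigma_finite_measure set T -> \bar R}) n :
  exists M : {sigma_finite_measure set (n.-tuple T) -> \bar R},
    M = power_measure mu n :> (set _ -> _).
Proof.
elim: n => [|n [M IH]]; first by exists \d_([tuple] : 0.-tuple T).
by have [M' M'E] := cons_measureP mu M; exists M'; rewrite M'E IH.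
Qed.

Lemma integral_power_measure_prod (mu : {sigma_finite_measure set T -> \bar R})
    n (f : 'I_n -> T -> R) (c : 'I_n -> R) :
  (forall i, measurable_fun setT (f i)) -> (forall i t, (0 <= f i t)%R) ->
  (forall i, \int[mu]_t (f i t)%:E = (c i)%:E) ->
  \int[power_measure mu n]_z (\prod_(i < n) f i (tnth z i))%:E =
  (\prod_(i < n) c i)%:E.
Proof.
elim: n f c => [|n IH] f c mf f0 fc.
  under eq_integral do rewrite big_ord0.
  by rewrite big_ord0 integral_cst//= diracT mule1.
have [M ME] := power_measureP mu n.
pose F (z : n.+1.-tuple T) := (\prod_(i < n.+1) f i (tnth z i))%:E.
have mF : measurable_fun setT F.
  apply/measurable_EFinP; apply: measurable_prod => i _.
  by apply: measurableT_comp; [exact: mf|exact: measurable_tnth].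
have F0 z : 0 <= F z by rewrite lee_fin prodr_ge0.
have mFt : measurable_fun setT (F \o tcons) := measurableT_comp mF measurable_tcons.
rewrite [power_measure _ _]/= -ME.
rewrite (@ge0_integral_pushforward _ _ _ _ _ _ measurable_tcons (mu \x M) setT F)//.
rewrite (_ : tcons @^-1` _ = setT)//.
rewrite (fubini_tonelli1 _ mFt) => [|p]; last exact: F0.
pose C := (\prod_(i < n) c (lift ord0 i))%R.
have gE x : \int[M]_y F (tcons (x, y)) = (f ord0 x)%:E * C%:E.
  rewrite -(IH (fun i => f (lift ord0 i)))// -ME.
  rewrite -ge0_integralZl//; last 3 first.
  - apply/measurable_EFinP; apply: measurable_prod => i _.
    by apply: measurableT_comp; [exact: mf|exact: measurable_tnth].
  - by move=> t _; rewrite lee_fin prodr_ge0.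
  - by rewrite lee_fin.
  apply: eq_integral => y _; rewrite /F big_ord_recl -EFinM; congr EFin.
  congr (f ord0 _ * _)%R; apply: eq_bigr => i _; congr (f _ _).
  by rewrite /tcons tnthS; congr tnth; exact: val_inj.
rewrite /fubini_F /=; under eq_integral do rewrite gE.
rewrite ge0_integralZr//.
- by rewrite fc -EFinM big_ord_recl.
- exact/measurable_EFinP.
- by move=> t _; rewrite lee_fin.
- rewrite lee_fin prodr_ge0// => i _.
  rewrite -lee_fin -fc; apply: integral_ge0 => t _; by rewrite lee_fin.
Qed.

(** The section of the event at a first sample x depends on x only through [pi x], so the integrand
    defining the product measure is a simple function, constant on the fibres of [pi]. *)
Lemma power_measure_finite (K : finType) (pi : T -> K) (q : K -> R)
    (mu : {measure set T -> \bar R}) n (A : pred (n.-tuple K)) :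
  (forall k, measurable (pi @^-1` [set k])) ->
  (forall k, mu (pi @^-1` [set k]) = (q k)%:E) ->
  power_measure mu n [set Z | A (map_tuple pi Z)] =
  (\sum_(X in A) \prod_(i < n) q (tnth X i))%:E.
Proof.
move=> mpi muq; have q0 k : (0 <= q k)%R by rewrite -lee_fin -muq measure_ge0.
elim: n A => [|n IH] A.
  rewrite /= diracE (_ : _ \in _ = ([tuple] \in A)).
    rewrite big_mkcond (big_pred1 [tuple]) => [|X]; last first.
      by apply/esym/eqP; exact: tuple0.
    by rewrite big_ord0; case: (_ \in A).
  apply/idP/idP; rewrite inE /= unfold_in.
    by rewrite (_ : map_tuple pi [tuple] = [tuple])//; exact: val_inj.
  by rewrite (_ : map_tuple pi [tuple] = [tuple])//; exact: val_inj.
pose G k := (\sum_(X : n.-tuple K | A [tuple of k :: X]) \prod_(i < n) q (tnth X i))%R.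
have G0 k : (0 <= G k)%R by apply: sumr_ge0 => X _; exact: prodr_ge0.
rewrite /= /pushforward /product_measure1.
rewrite (eq_integral (fun x => \sum_(k : K) ((G k)%:E * (\1_(pi @^-1` [set k])
  x)%:E))); last first.
  move=> x _; rewrite (bigD1 (pi x))//= big1 ?adde0 => [|k kx]; last first.
    by rewrite indicE memNset ?mule0// => /= E; rewrite E eqxx in kx.
  rewrite indicE mem_set//= mule1 -(IH [pred X : n.-tuple K | A [tuple of pi x :: X]]).
  congr (power_measure _ _ _); apply/seteqP; split=> z /=.
    by rewrite /xsection /= inE /= /tcons; congr A; exact: val_inj.
  by rewrite /xsection /= inE /=; congr A; exact: val_inj.
rewrite ge0_integral_sum//; last 2 first.
- by move=> k; apply: measurable_funeM; apply/measurable_EFinP; exact: measurable_indic.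
- by move=> k x _; rewrite mule_ge0// lee_fin.
have Ik k : \int[mu]_x ((G k)%:E * (\1_(pi @^-1` [set k]) x)%:E) = (G k * q k)%:E.
  rewrite (ge0_integralZl mu measurableT (f := fun x => (\1_(pi @^-1` [set k]) x)%:E))//.
  - by rewrite integral_indic// setIT EFinM; congr (_ * _); exact: muq.
  - by apply/measurable_EFinP; exact: measurable_indic.
  - by rewrite lee_fin.
rewrite (eq_bigr _ (fun k _ => Ik k)).
rewrite sumEFin; congr EFin.
transitivity (\sum_(p : K * n.-tuple K | A [tuple of p.1 :: p.2])
    q p.1 * \prod_(i < n) q (tnth p.2 i))%R.
  rewrite -(pair_big_dep xpredT (fun (k : K) (X : n.-tuple K) => A [tuple of k :: X])
    (fun k X => q k * \prod_(i < n) q (tnth X i))%R) /=.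
  by apply: eq_bigr => k _; rewrite /G mulr_suml; apply: eq_bigr => X _; rewrite mulrC.
rewrite [RHS](reindex (fun p : K * n.-tuple K => [tuple of p.1 :: p.2])) /=.
  apply: eq_bigr => -[k X] _; rewrite big_ord_recl; congr (q _ * _)%R.
  by apply: eq_bigr => i _; rewrite tnthS; congr (q (tnth _ _)); exact: val_inj.
exists (fun X : n.+1.-tuple K => (thead X, [tuple of behead X])) => [[k X]|X] _ /=.
  by congr pair; exact: val_inj.
by rewrite [RHS]tuple_eta; exact: val_inj.
Qed.

End power_measure.

(** * The spiked normal density *)

(** Sylvester's determinant identity, from two block triangular factorisations of the same
    matrix. *)
Lemma det_1DmulC (R : comPzRingType) m n (A : 'M[R]_(m, n)) (B : 'M[R]_(n, m)) :
  \det (1%:M + A *m B) = \det (1%:M + B *m A).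
Proof.
have E1 : block_mx 1%:M (- A) B 1%:M =
    block_mx 1%:M 0 B 1%:M *m block_mx 1%:M (- A) 0 (1%:M + B *m A).
  rewrite mulmx_block !mul1mx !mul0mx ?mulmx0 ?mulmx1 ?addr0 mulmxN.
  by rewrite addrCA addNr addr0.
have E2 : block_mx 1%:M (- A) B 1%:M =
    block_mx (1%:M + A *m B) (- A) 0 1%:M *m block_mx 1%:M 0 B 1%:M.
  rewrite mulmx_block ?mul1mx ?mul0mx ?mulmx0 ?mulmx1 ?add0r mulNmx.
  by rewrite addrK.
have := congr1 determinant E1; rewrite E2 !det_mulmx det_lblock !det_ublock !det1.
by rewrite !mulr1 !mul1r.
Qed.

Section spiked_normal.
Context {R : realType} {d : nat}.
Implicit Types (S : {set 'I_d}) (a : R) (z : d.-tuple R).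

Definition spike S : 'cV[R]_d := \col_j (j \in S)%:R.

(** The covariance of xi + a g 1_S with xi and g independent and standard normal, whence the square
    of [a]. *)
Definition spiked_mx S a : 'M[R]_d := 1%:M + a ^+ 2 *: (spike S *m (spike S)^T).

Lemma spike_sqr S : (spike S)^T *m spike S = #|S|%:R%:M.
Proof.
apply/matrixP => i j; rewrite !ord1 !mxE eqxx mulr1n -sum1_card natr_sum [RHS]big_mkcond.
by apply: eq_bigr => k _; rewrite !mxE; case: (k \in S); rewrite ?mulr1 ?mulr0.
Qed.

Lemma det_spiked_mx S a : \det (spiked_mx S a) = 1 + #|S|%:R * a ^+ 2.
Proof.
rewrite /spiked_mx scalemxAl det_1DmulC -scalemxAr spike_sqr.
by rewrite det_mx11 !mxE mulrC.
Qed.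

(** The Sherman-Morrison formula; it rests on [N *m N = s *: N] for the rank-one matrix of the
    spike. *)
Lemma invmx_spiked_mx S a : invmx (spiked_mx S a) =
  1%:M - (a ^+ 2 / (1 + #|S|%:R * a ^+ 2)) *: (spike S *m (spike S)^T).
Proof.
set s := #|S|%:R; set t := 1 + s * a ^+ 2.
have t0 : t != 0 by rewrite lt0r_neq0// ltr_pwDl// mulr_ge0 ?sqr_ge0// /s.
have E : spiked_mx S a *m (1%:M - (a ^+ 2 / t) *: (spike S *m (spike S)^T)) = 1%:M.
  set N := spike S *m _.
  have NN : N *m N = s *: N.
    by rewrite /N mulmxA -(mulmxA (spike S)) spike_sqr scalar_mxC mul_scalar_mx -scalemxAl.
  rewrite /spiked_mx -/N mulmxDl mul1mx mulmxBr mulmx1 -scalemxAl -scalemxAr NN !scalerA.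
  rewrite -addrA -scaleNr -scalerBl -scalerDl.
  rewrite [X in X *: N](_ : _ = 0) ?scale0r ?addr0//.
  rewrite (_ : _ + _ = a ^+ 2 * (1 - (1 + s * a ^+ 2) * t^-1)); last by lra.
  by rewrite -/t mulfV// subrr mulr0.
have [u _] := mulmx1_unit E.
by move/(congr1 (mulmx (invmx (spiked_mx S a)))): E; rewrite mulKmx// mulmx1 => <-.
Qed.

Lemma spiked_mvnormal_pdfE S a z : mvnormal_pdf (spiked_mx S a) z =
  (Num.sqrt ((2 * pi) ^+ d * (1 + #|S|%:R * a ^+ 2)))^-1 *
  expR (- (1 / 2) * ((\sum_(j < d) tnth z j ^+ 2) -
    a ^+ 2 / (1 + #|S|%:R * a ^+ 2) * (\sum_(j in S) tnth z j) ^+ 2)).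
Proof.
rewrite /mvnormal_pdf det_spiked_mx invmx_spiked_mx; congr (_ * expR (_ * _)).
set x := \row_j _; rewrite mulmxBr mulmx1 mulmxBl -scalemxAr -scalemxAl.
rewrite (_ : x *m _ *m x^T = (x *m spike S) *m (x *m spike S)^T); last first.
  by rewrite trmx_mul !mulmxA.
rewrite mxE [in X in _ + X]mxE [in X in _ + X]mxE; congr (_ - _ * _).
  by rewrite mxE; apply: eq_bigr => j _; rewrite !mxE -expr2.
rewrite mxE big_ord1 [in X in _ * X]mxE -expr2; congr (_ ^+ 2).
rewrite mxE [RHS]big_mkcond; apply: eq_bigr => j _; rewrite !mxE.
by case: (j \in S); rewrite ?mulr1 ?mulr0.
Qed.

Lemma measurable_spiked_mvnormal_pdf S a :
  measurable_fun setT (mvnormal_pdf (spiked_mx S a)).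
Proof.
have mt (j : 'I_d) : measurable_fun setT (fun z : d.-tuple R => tnth z j) := measurable_tnth j.
rewrite (funext (spiked_mvnormal_pdfE S a)).
apply: measurable_funM => //; apply: measurableT_comp => //.
apply: measurable_funM => //; apply: measurable_funB.
  by apply: measurable_sum => j; apply: measurable_funX.
apply: measurable_funM => //; apply: measurable_funX.
under eq_fun do rewrite big_mkcond.
by apply: measurable_sum => j; case: (j \in S).
Qed.

(** Given g, the coordinates are independent with means a g on [S] and 0 elsewhere. The product of
    their densities is exponential-quadratic in g, so [gmean_tilt] evaluates the mixture. *)
Lemma spiked_mvnormal_pdf_mixture S a z :
  mvnormal_pdf (spiked_mx S a) z =
  gmean (fun g => \prod_(j < d) normal_pdf (a * (j \in S)%:R * g) 1 (tnth z j)).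
Proof.
set Q := \sum_(j < d) tnth z j ^+ 2; set V := \sum_(j in S) tnth z j.
set s : R := #|S|%:R; have A1 : -1 < s * a ^+ 2.
  by rewrite (lt_le_trans (ltrN10 _))// mulr_ge0 ?sqr_ge0// /s.
rewrite spiked_mvnormal_pdfE -/Q -/V -/s.
rewrite (@eq_gmean _ _ (fun g => (normal_peak 1 ^+ d * expR (- (Q / 2))) *
    expR (a * V * g - s * a ^+ 2 * g ^+ 2 / 2))); last first.
  move=> g; rewrite -mulrA -expRD.
  under eq_bigr do rewrite normal_pdfE// /normal_fun.
  rewrite big_split /= prodr_const card_ord -expR_sum; congr (_ * expR _).
  transitivity (\sum_(j < d) (- (tnth z j ^+ 2 / 2) + ((a * g) * ((j \in S)%:R * tnth z j)
     - (a ^+ 2 * g ^+ 2 / 2) * (j \in S)%:R))).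
    by apply: eq_bigr => j _; rewrite expr1n; case: (j \in S) => /=; lra.
  rewrite big_split /= sumrB -!mulr_sumr sumrN -mulr_suml -/Q.
  have -> : \sum_(j < d) (j \in S)%:R * tnth z j = V.
    by rewrite /V [RHS]big_mkcond; apply: eq_bigr => j _; case: (j \in S);
      rewrite ?mul1r ?mul0r.
  have -> : \sum_(j < d) (j \in S)%:R = s :> R.
    by rewrite /s -sum1_card natr_sum [RHS]big_mkcond; apply: eq_bigr => j _; case: (j \in S).
  by lra.
rewrite gmeanZ ?gmean_tilt//; last exact: gintegrable_tilt.
have pk : (Num.sqrt ((2 * pi) ^+ d * (1 + s * a ^+ 2)))^-1 =
    normal_peak 1 ^+ d * (Num.sqrt (1 + s * a ^+ 2))^-1.
  have pi2 : 0 <= 2 * pi :> R by rewrite mulr_ge0// pi_ge0.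
  rewrite sqrtrM ?exprn_ge0// -[in (2 * pi) ^+ d](sqr_sqrtr pi2) -exprM mulnC exprM.
  rewrite sqrtr_sqr ger0_norm ?exprn_ge0 ?sqrtr_ge0//.
  by rewrite invfM -exprVn /normal_peak expr1n mul1r mulr_natl.
rewrite pk [RHS]mulrACA -expRD; congr (_ * expR _).
rewrite invfM; set I := (1 + _)^-1; lra.
Qed.

End spiked_normal.

(** * Orthant probabilities *)

Section orthants.
Context {R : realType}.
Local Open Scope classical_set_scope.
Notation mu := (@lebesgue_measure R).

Lemma EFin_gmean (f : R -> R) : gintegrable f ->
  (\int[mu]_g (normal_pdf 0 1 g * f g)%:E = (gmean f)%:E)%E.
Proof. by move=> i; rewrite fineK//; exact: integrable_fin_num i. Qed.

Section fixed_dimension.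
Context {d : nat}.
Implicit Types (S : {set 'I_d}) (a : R) (x : d.-tuple bool) (z : d.-tuple R).

Lemma measurable_sgb_eq b : measurable_fun setT (fun t : R => (sgb t == b)%:R : R).
Proof.
rewrite (_ : (fun _ => _) = \1_(if b then `[0, +oo[ else `]-oo, 0[)).
  by apply: measurable_indic; case: b.
apply/funext => t; rewrite indicE /sgb; case: b.
  by rewrite mem_setE in_itv /= andbT eqb_id.
by rewrite mem_setE in_itv /= eqbF_neg -ltNge.
Qed.

Definition orthant x : set (d.-tuple R) := map_tuple sgb @^-1` [set x].

Lemma orthantE x z : (z \in orthant x)%:R = \prod_(j < d) (sgb (tnth z j) == tnth x j)%:R :> R.
Proof.
have [|zx] := boolP (z \in orthant x).
  by rewrite inE => <-; rewrite big1// => j _; rewrite tnth_map eqxx.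
have /existsP[j jx] : [exists j, sgb (tnth z j) != tnth x j].
  rewrite -negb_forall; apply: contra zx => /forallP zx; rewrite inE.
  by apply: eq_from_tnth => j; rewrite tnth_map; exact/eqP.
by rewrite (bigD1 j)//= (negbTE jx) mul0r.
Qed.

Lemma measurable_orthant x : measurable (orthant x).
Proof.
rewrite (_ : orthant x = (fun z =>
  \prod_(j < d) (sgb (tnth z j) == tnth x j)%:R : R) @^-1` [set 1]).
  rewrite -[X in measurable X]setTI.
  have : measurable_fun setT (fun z : d.-tuple R =>
    \prod_(j < d) (sgb (tnth z j) == tnth x j)%:R : R).
    apply: measurable_prod => j _.
    by apply: (measurableT_comp (measurable_sgb_eq (tnth x j))); exact: measurable_tnth.
  by apply => //; exact: measurable_set1.
apply/seteqP; split=> z /=; rewrite -orthantE.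
  by move=> /mem_set ->.
by have [/set_mem//|_ /eqP] := boolP (z \in orthant x); rewrite eq_sym oner_eq0.
Qed.

Lemma prod_sign_weight S a x g :
  \prod_(j < d) sign_weight (tnth x j) (a * (j \in S)%:R * g) =
  (2 ^+ d)^-1 * lin_prod S (sign_mean (a * g)) x.
Proof.
under eq_bigr do rewrite sign_weightE.
rewrite prodf_div prodr_const card_ord mulrC; congr (_ * _).
rewrite /lin_prod [RHS]big_mkcond; apply: eq_bigr => j _; case: (j \in S).
  by rewrite mulr1.
by rewrite mulr0 mul0r /sign_mean oppr0 subrr mulr0 addr0.
Qed.

(** Tonelli exchanges z with the mixing variable g; for fixed g the coordinates are independent and
    the orthant mass factorises into sign probabilities. *)
Lemma mvnormal_orthant S a x :
  mvnormal (spiked_mx S a) (orthant x) =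
  ((2 ^+ d)^-1 * gmean (fun g => lin_prod S (sign_mean (a * g)) x))%:E.
Proof.
have [M ME] := power_measureP mu d.
pose m j g := a * (j \in S)%:R * g.
pose w (p : d.-tuple R * R) := normal_pdf 0 1 p.2 *
  \prod_(j < d) ((sgb (tnth p.1 j) == tnth x j)%:R * normal_pdf (m j p.2) 1 (tnth p.1 j)).
have w0 p : 0 <= w p.
  by rewrite mulr_ge0 ?normal_pdf_ge0// prodr_ge0// => j _; rewrite mulr_ge0 ?normal_pdf_ge0.
have mpdf : measurable_fun setT (normal_pdf 0 1 : R -> R) by exact: measurable_normal_pdf.
have mt j : measurable_fun setT (fun p : d.-tuple R * R => tnth p.1 j).
  by apply: (measurableT_comp (measurable_tnth j)).
have mw : measurable_fun setT (fun p => (w p)%:E).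
  apply/measurable_EFinP; apply: measurable_funM; first exact: measurableT_comp.
  apply: measurable_prod => j _; apply: measurable_funM.
    by apply: (measurableT_comp (measurable_sgb_eq (tnth x j))).
  under eq_fun do rewrite normal_pdf_shift.
  apply: measurableT_comp => //; apply: measurable_funB => //.
  exact: measurable_funM.
have ib z : gintegrable (fun g => \prod_(j < d) normal_pdf (m j g) 1 (tnth z j)).
  apply: (@gintegrable_bounded _ _ (normal_peak 1 ^+ d)).
    apply: measurable_prod => j _; under eq_fun do rewrite normal_pdf_shift.
    apply: measurableT_comp => //; apply: measurable_funB => //.
    exact: measurable_funM.
  move=> g; rewrite ger0_norm ?prodr_ge0// => [|j _]; last exact: normal_pdf_ge0.
  rewrite -[d in leRHS]card_ord -prodr_const; apply: ler_prod => j _.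
  by rewrite normal_pdf_ge0 normal_pdf_ub.
transitivity (\int[M]_(z in orthant x) (mvnormal_pdf (spiked_mx S a) z)%:E)%E.
  by rewrite ME.
rewrite integral_mkcond.
transitivity (\int[M]_z \int[mu]_g (w (z, g))%:E)%E.
  apply: eq_integral => z _; rewrite patchE.
  transitivity ((z \in orthant x)%:R * mvnormal_pdf (spiked_mx S a) z)%:E.
    by case: ifP; rewrite ?mul1r ?mul0r.
  rewrite spiked_mvnormal_pdf_mixture -gmeanZ// -EFin_gmean; last exact: gintegrableZ.
  by apply: eq_integral => g _; rewrite /w big_split /= -orthantE.
transitivity (\int[mu]_g \int[M]_z (w (z, g))%:E)%E.
  by apply: (fubini_tonelli (m1 := M) (m2 := mu) _ mw) => p; rewrite lee_fin.
have ilp := gintegrable_lin_prod S a x.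
rewrite -gmeanZ// -EFin_gmean; last exact: gintegrableZ.
apply: eq_integral => g _.
under eq_integral do rewrite /w /= EFinM.
rewrite ge0_integralZl//; last 3 first.
- apply/measurable_EFinP; apply: measurable_prod => j _; apply: measurable_funM.
    by apply: (measurableT_comp (measurable_sgb_eq (tnth x j))); exact: measurable_tnth.
  by apply: (measurableT_comp (measurable_normal_pdf _ _)); exact: measurable_tnth.
- by move=> z _; rewrite lee_fin prodr_ge0// => j _; rewrite mulr_ge0 ?normal_pdf_ge0.
- by rewrite lee_fin normal_pdf_ge0.
rewrite EFinM -prod_sign_weight; congr (_ * _)%E.
have := @integral_power_measure_prod _ _ _ mu d
  (fun j t => (sgb t == tnth x j)%:R * normal_pdf (m j g) 1 t)
  (fun j => sign_weight (tnth x j) (m j g)).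
rewrite -ME; apply => [j|j t|j].
- by apply: measurable_funM; [exact: measurable_sgb_eq|exact: measurable_normal_pdf].
- by rewrite mulr_ge0 ?normal_pdf_ge0.
- exact: integral_sign_weight.
Qed.

Lemma mvnormal_measureP S a :
  exists nu : {measure set (d.-tuple R) -> \bar R},
    nu = mvnormal (spiked_mx S a) :> (set _ -> _).
Proof.
have [M ME] := power_measureP mu d; set nu := mvnormal _.
have nuE A : nu A = (\int[M]_(z in A) (mvnormal_pdf (spiked_mx S a) z)%:E)%E by rewrite ME.
have pdf0 z : (0 <= (mvnormal_pdf (spiked_mx S a) z)%:E)%E.
  by rewrite lee_fin mulr_ge0 ?expR_ge0// invr_ge0 sqrtr_ge0.
have nu0 : nu set0 = 0%E by rewrite nuE integral_set0.
have nu_ge0 A : (0 <= nu A)%E by rewrite nuE integral_ge0.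
have nu_add : semi_sigma_additive nu.
  move=> F mF tF mUF; rewrite nuE ge0_integral_bigcup//; last first.
    by apply/measurable_funTS/measurable_EFinP; exact: measurable_spiked_mvnormal_pdf.
  rewrite (_ : (fun _ => _) = (fun n =>
    \sum_(0 <= i < n) \int[M]_(z in F i) (mvnormal_pdf (spiked_mx S a) z)%:E)%E); last first.
    by apply/funext => n; apply: eq_bigr => i _; rewrite nuE.
  by apply: is_cvg_ereal_nneg_natsum => i _; exact: integral_ge0.
pose H := isMeasure.Build _ _ _ nu nu0 nu_ge0 nu_add.
by exists (HB.pack_for (Measure.type (d.-tuple R) R) nu H).
Qed.

Lemma gauss_law_signs S a n (A : pred (n.-tuple (d.-tuple bool))) :
  gauss_law (spiked_mx S a) [set Z | A (signs Z)] =
  (\sum_(X in A) \prod_(i < n) ((2 ^+ d)^-1 *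
     gmean (fun g => lin_prod S (sign_mean (a * g)) (tnth X i))))%:E.
Proof.
have [nu nuE] := mvnormal_measureP S a.
rewrite /gauss_law -nuE /signs.
apply: (@power_measure_finite _ _ _ _ (map_tuple sgb)
  (fun x => (2 ^+ d)^-1 * gmean (fun g => lin_prod S (sign_mean (a * g)) x))).
  exact: measurable_orthant.
by move=> x; rewrite nuE; exact: mvnormal_orthant.
Qed.

End fixed_dimension.
End orthants.

(** * Chi-square divergence of one sign vector from the Curie-Weiss law *)

Section chi_square.
Context {R : realType} {d : nat}.
Implicit Types (S : {set 'I_d}) (b theta : R) (x : d.-tuple bool).

Definition spin_sum S x : R := \sum_(j in S) spin (tnth x j).

Definition curie_weiss S theta x : R :=
  expR (theta * spin_sum S x ^+ 2) / \sum_y expR (theta * spin_sum S y ^+ 2).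

Definition sign_pmf S b x : R := (2 ^+ d)^-1 * spiked_density S b x.

Lemma card_cube : #|{: d.-tuple bool}|%:R = 2 ^+ d :> R.
Proof. by rewrite card_tuple card_bool natrX. Qed.

Lemma sum_expR_gt0 (F : d.-tuple bool -> R) : 0 < \sum_y expR (F y).
Proof.
by rewrite (bigD1 [tuple of nseq d true])//= ltr_pwDl ?expR_gt0// sumr_ge0// => y _;
  exact: expR_ge0.
Qed.

Lemma curie_weiss_gt0 S theta x : 0 < curie_weiss S theta x.
Proof. by rewrite divr_gt0 ?expR_gt0 ?sum_expR_gt0. Qed.

Lemma sum_curie_weiss S theta : \sum_x curie_weiss S theta x = 1.
Proof. by rewrite -mulr_suml mulfV// lt0r_neq0 ?sum_expR_gt0. Qed.

Lemma sum_sign_pmf S b : \sum_x sign_pmf S b x = 1.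
Proof.
have il := gintegrable_lin_prod S (b / sign_slope).
have [_ E] := gmean_sum il; rewrite -mulr_sumr -E.
rewrite (@eq_gmean _ _ (fun=> 2 ^+ d)); first by rewrite gmean_cst mulVf// expf_neq0.
move=> g; set h := sign_mean _.
have l1 x : lin_prod S 0 x = 1 :> R.
  by rewrite /lin_prod big1// => j _; rewrite mulr0 addr0.
have := umean_lin_prodM S h 0; rewrite mulr0 addr0 expr1n.
under eq_umean do rewrite l1 mulr1.
by rewrite /umean => /(canRL (divfK _)) ->; rewrite ?mul1r// expf_neq0.
Qed.

(* Let L and P be the densities of sign_pmf and curie_weiss with respect to the
   uniform law, G = gauss_density = m P, and e the mean of (L - G)^2 / G.  The sum
   is m (2 - m + e) <= 1 + e + e^2 / 4, whatever m. *)
Lemma chi_square_sign_pmf S b theta : (0 < #|S|)%N -> #|S|%:R * b ^+ 2 <= 16^-1 ->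
  theta = b ^+ 2 / (2 * (1 + #|S|%:R * b ^+ 2)) ->
  \sum_x sign_pmf S b x ^+ 2 / curie_weiss S theta x <=
  1 + (2 * dist_const + dist_const ^+ 2) * b ^+ 4.
Proof.
set s : R := #|S|%:R => S0 sb thetaE.
have s1 : 1 <= s by rewrite /s ler1n.
have b20 : 0 <= b ^+ 2 := sqr_ge0 b.
have sb0 : 0 <= s * b ^+ 2 by rewrite mulr_ge0// /s.
have b21 : b ^+ 2 <= 1.
  by rewrite (le_trans (ler_peMl b20 s1))// (le_trans sb)//; lra.
pose L := spiked_density S b; pose G := gauss_density S b.
set k := (Num.sqrt (1 + s * b ^+ 2))^-1.
have GE x : G x = k * expR (theta * spin_sum S x ^+ 2) by rewrite /G gauss_densityE thetaE.
have r0 : 0 < Num.sqrt (1 + s * b ^+ 2) by rewrite sqrtr_gt0; lra.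
have r2 : Num.sqrt (1 + s * b ^+ 2) <= 2.
  have -> : 2 = Num.sqrt (2 ^+ 2) :> R by rewrite sqrtr_sqr ger0_norm.
  by rewrite ler_sqrt; lra.
have k0 : 0 < k by rewrite invr_gt0.
have G0 x : 0 < G x by rewrite GE mulr_gt0// expR_gt0.
(* Since theta >= 0, [G] is at least [k], and [k] is at least 1/2; dividing by [G] thus costs a
   factor 2 only. *)
have GV x : (G x)^-1 <= 2.
  have W1 : (expR (theta * spin_sum S x ^+ 2))^-1 <= 1.
    rewrite invf_le1 ?expR_gt0// -expR0 ler_expR mulr_ge0 ?sqr_ge0//.
    by rewrite thetaE divr_ge0// mulr_ge0//; lra.
  rewrite GE invfM /k invrK -[leRHS]mulr1.
  by apply: ler_pM => //; rewrite ?invr_ge0 ?expR_ge0 ?sqrtr_ge0.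
pose m := umean G; pose e := umean (fun x => (L x - G x) ^+ 2 / G x).
have e0 : 0 <= e.
  rewrite divr_ge0 ?exprn_ge0// sumr_ge0// => x _.
  by rewrite divr_ge0 ?sqr_ge0// ltW.
have D0 : 0 <= dist_const :> R := dist_const_ge0.
have e1 : e <= 2 * (dist_const * b ^+ 4).
  apply: le_trans (ler_wpM2l (ler0n _ 2) (spiked_gauss_dist sb)).
  rewrite -umeanZ; apply: ler_umean => x.
  by rewrite mulrC ler_wpM2r ?sqr_ge0.
have L1 : umean L = 1.
  by have := sum_sign_pmf S b; rewrite -mulr_sumr mulrC.
have qE x : sign_pmf S b x ^+ 2 / curie_weiss S theta x = (2 ^+ d)^-1 * (m * (L x ^+ 2 / G x)).
  have -> : curie_weiss S theta x = G x / (2 ^+ d * m).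
    rewrite /m /umean mulrCA mulfV ?expf_neq0// mulr1.
    under eq_bigr do rewrite GE; rewrite -mulr_sumr GE.
    by rewrite invfM mulrACA mulfV ?mul1r// lt0r_neq0.
  rewrite invfM invrK /sign_pmf -/(L x) exprMn.
  rewrite [in LHS]expr2 -(mulrA (2 ^+ d)^-1) -mulrA; congr (_ * _).
  rewrite [X in X = _](_ : _ = ((2 ^+ d)^-1 * 2 ^+ d) * (m * (L x ^+ 2 * (G x)^-1)));
    last by lra.
  by rewrite mulVf ?expf_neq0// mul1r.
rewrite (eq_bigr _ (fun x _ => qE x)) -mulr_sumr mulrC.
rewrite -[X in X <= _]/(umean (fun x => m * (L x ^+ 2 / G x))) umeanZ.
have -> : umean (fun x => L x ^+ 2 / G x) = 2 - m + e.
  rewrite (@eq_umean _ _ _ (fun x => (2 * L x + -1 * G x) + (L x - G x) ^+ 2 / G x));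
    last first.
    move=> x; have := mulfV (lt0r_neq0 (G0 x)); set V := (G x)^-1 => GVE.
    rewrite [RHS](_ : _ = L x ^+ 2 * V + (2 * L x - G x) * (1 - G x * V)); last by lra.
    by rewrite GVE subrr mulr0 addr0.
  by rewrite !umeanD !umeanZ L1 mulr1 mulN1r.
set D := dist_const * b ^+ 4 in e1.
have b41 : b ^+ 4 <= 1 by rewrite (exprM b 2 2); apply: exprn_ile1.
have b40 : 0 <= b ^+ 4 by rewrite exprn_even_ge0.
have D1 : D ^+ 2 <= dist_const ^+ 2 * b ^+ 4.
  rewrite /D exprMn ler_wpM2l ?sqr_ge0// -[leRHS]mulr1.
  by rewrite expr2 ler_wpM2l.
have e2 : e ^+ 2 <= 4 * D ^+ 2.
  rewrite (_ : 4 * D ^+ 2 = (2 * D) ^+ 2); last by lra.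
  by apply: lerXn2r; rewrite ?nnegrE// (le_trans e0).
(* m (2 - m + e) is largest at m = 1 + e/2. With e <= 2 D and D^2 <= [dist_const ^+ 2 * b ^+ 4], the
   maximum 1 + e + e^2/4 yields the stated constant. *)
have sq := sqr_ge0 (m - 1 - e / 2).
move: e1 e2 D1 sq; rewrite /D; move: (dist_const) => DD; clearbody m e.
by move=> e1 e2 D1 sq; nra.
Qed.

End chi_square.

(** * Clique Ising models *)

Section clique_ising.
Context {R : realType} {d : nat}.
Implicit Types (S : {set 'I_d}) (theta : R) (x : d.-tuple bool).

Definition clique_mx S theta : 'M[R]_d :=
  \matrix_(i, j) (if [&& i \in S, j \in S & i != j] then theta else 0).

(** Squaring the spin sum adds the diagonal terms, each equal to theta because spins square to 1.
    The compensating factor is constant and cancels in the normalisation. *)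
Lemma ising_weight_clique S theta x : ising_weight (clique_mx S theta) x =
  expR (theta * spin_sum S x ^+ 2) * expR (- (theta * #|S|%:R)).
Proof.
rewrite -expRD; congr expR.
pose y i : R := if i \in S then spin (tnth x i) else 0.
have yS : \sum_i y i = spin_sum S x by rewrite /spin_sum [RHS]big_mkcond.
have y2 : \sum_i y i ^+ 2 = #|S|%:R.
  rewrite -sum1_card natr_sum [RHS]big_mkcond; apply: eq_bigr => i _.
  by rewrite /y /spin; case: (i \in S); case: (tnth x i); rewrite ?expr0n// ?sqrrN expr1n.
rewrite -yS -y2 expr2 mulr_suml -mulrBr -sumrB mulr_sumr; apply: eq_bigr => i _.
rewrite (bigD1 i)//= mxE eqxx !andbF !mul0r add0r.
rewrite [in RHS](bigD1 i)//=.
rewrite [X in _ * X](_ : _ = y i * \sum_(j < d | j != i) y j); last by lra.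
rewrite !mulr_sumr; apply: eq_bigr => j ji.
rewrite mxE [i == j]eq_sym ji andbT /y.
by case: (i \in S); case: (j \in S); rewrite /= ?mul0r ?mulr0// mulrA.
Qed.

Lemma ising_pmf_clique S theta : ising_pmf (clique_mx S theta) = curie_weiss S theta.
Proof.
apply/funext => x; rewrite /ising_pmf /curie_weiss.
under eq_bigr do rewrite ising_weight_clique.
rewrite -mulr_suml ising_weight_clique invfM mulrACA mulfV ?mulr1//.
by rewrite lt0r_neq0// expR_gt0.
Qed.

Lemma frobenius_clique S theta : 0 <= theta ->
  frobenius (clique_mx S theta) <= #|S|%:R * theta.
Proof.
move=> t0; rewrite /frobenius -(ger0_norm (mulr_ge0 (ler0n _ _) t0)) -sqrtr_sqr.
rewrite ler_sqrt ?sqr_ge0//.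
have -> : (#|S|%:R * theta) ^+ 2 =
    \sum_i \sum_j (if (i \in S) && (j \in S) then theta ^+ 2 else 0).
  rewrite exprMn expr2 -!mulrA mulr_natl -sumr_const [RHS](bigID (mem S)) /=.
  rewrite [X in _ = _ + X]big1 ?addr0 => [|i /negbTE ->]; last by rewrite big1.
  apply: eq_bigr => i iS; rewrite mulr_natl -sumr_const [LHS]big_mkcond.
  by apply: eq_bigr => j _; rewrite iS.
apply: ler_sum => i _; apply: ler_sum => j _; rewrite mxE.
case: (i \in S); case: (j \in S); rewrite /= ?expr0n//=.
by case: eqP; rewrite ?expr0n ?sqr_ge0.
Qed.

Lemma enum_complete S : uniq (enum S ++ enum (~: S)).
Proof.
rewrite cat_uniq !enum_uniq andbT; apply/hasPn => i.
by rewrite !mem_enum inE.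
Qed.

Lemma mem_enum_complete S i : i \in enum S ++ enum (~: S).
Proof. by rewrite mem_cat !mem_enum inE orbN. Qed.

(** List each set followed by its complement and match the positions. *)
Lemma exists_inj_set S1 S2 : #|S1| = #|S2| ->
  exists2 f : 'I_d -> 'I_d, injective f & forall i, i \in S1 -> f i \in S2.
Proof.
move=> S12; pose e S := enum S ++ enum (~: S).
have size_e S : size (e S) = d.
  by rewrite size_cat -!cardE cardsC card_ord.
exists (fun i => nth i (e S2) (index i (e S1))) => [i j|i iS1].
  have id k : (index k (e S1) < d)%N by have := mem_enum_complete S1 k;
    rewrite -index_mem size_e.
  rewrite (set_nth_default i j) ?size_e// => /eqP.
  rewrite nth_uniq ?size_e ?enum_complete// => /eqP ij.
  by rewrite -(nth_index i (mem_enum_complete S1 i)) -/(e S1) ij nth_index// mem_enum_complete.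
rewrite /e index_cat mem_enum iS1 nth_cat -cardE -S12.
have lt : (index i (enum S1) < #|S1|)%N by rewrite cardE index_mem mem_enum.
by rewrite lt -mem_enum mem_nth// -cardE -S12.
Qed.

(** Containment is up to isomorphism, so the clique may sit on any vertex set of the right size.
    Hence every spike support has its own Ising alternative in the class. *)
Lemma clique_mx_class S theta (G : rel 'I_d) : 0 < theta ->
  #|S|%:R * theta <= 1 / 2 -> clique_graph #|S| G ->
  ising_class (graphs_containing G) theta (clique_mx S theta).
Proof.
move=> t0 st [S0 S0S GE]; split.
- by apply/matrixP => i j; rewrite !mxE [j == i]eq_sym andbCA.
- by move=> i; rewrite mxE eqxx !andbF.
- have gE i j : graph_of (clique_mx S theta) i j = [&& i \in S, j \in S & i != j].
    by rewrite /graph_of mxE; case: ifP => _; rewrite ?eqxx// lt0r_neq0.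
  split.
    by split=> [i j|i]; rewrite !gE ?eqxx ?andbF// [j == i]eq_sym andbCA.
  have [f injf fS] := exists_inj_set S0S; exists f => // i j.
  by rewrite GE gE => /and3P[iS jS ij]; rewrite !fS// (inj_eq injf).
- exact: le_trans (frobenius_clique S (ltW t0)) st.
- by move=> i j; rewrite /graph_of mxE; case: ifP => // _ /eqP.
Qed.

(** The identity is the spiked matrix with empty support, so the null case is an instance of
    [gauss_law_signs]. *)
Lemma ising_law0 n (A : {pred n.-tuple (d.-tuple bool)}) :
  (@ising_law R d 0 n A)%:E = gauss_law 1%:M [set Z | A (signs Z)].
Proof.
have -> : 1%:M = spiked_mx finset.set0 0 :> 'M[R]_d.
  by rewrite /spiked_mx expr0n scale0r addr0.
rewrite gauss_law_signs; congr EFin; apply: eq_bigr => X _; apply: eq_bigr => i _.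
rewrite (@eq_gmean _ _ (fun=> 1)) => [|g]; last by rewrite /lin_prod finset.big_set0.
have w0 x : ising_weight (0 : 'M[R]_d) x = 1.
  rewrite /ising_weight big1 ?expR0// => j _; rewrite big1// => k _.
  by rewrite mxE !mul0r.
rewrite gmean_cst mulr1 /ising_pmf w0 mul1r; congr (_^-1).
by rewrite (eq_bigr (fun=> 1)) => [|y _]; rewrite ?w0// sumr_const card_cube.
Qed.

Lemma spiked_covP s sigma Sigma : spiked_cov d s (sigma ^+ 2) Sigma ->
  exists2 S : {set 'I_d}, #|S| = s & Sigma = spiked_mx S sigma :> 'M[R]_d.
Proof.
move=> [i injf ->]; pose S : {set 'I_d} := (i @: [set: 'I_s])%SET.
exists S; first by rewrite card_imset// cardsT card_ord.
rewrite /spiked_mx (_ : \sum_(k < s) delta_mx (i k) 0 = spike S)//.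
apply/matrixP => j l; rewrite ord1 summxE mxE.
have [/imsetP[k _ ->]|jS] := boolP (j \in S).
  rewrite (bigD1 k)//= mxE !eqxx big1 ?addr0// => m mk.
  by rewrite mxE (inj_eq injf) eq_sym (negbTE mk).
rewrite big1// => k _; rewrite mxE; case: eqP => // jk.
by rewrite jk imset_f in jS.
Qed.

Lemma gauss_law_le_ising S b theta n (A : pred (n.-tuple (d.-tuple bool))) :
  (0 < #|S|)%N -> #|S|%:R * b ^+ 2 <= 16^-1 ->
  theta = b ^+ 2 / (2 * (1 + #|S|%:R * b ^+ 2)) ->
  (gauss_law (spiked_mx S (b / sign_slope)) [set Z | A (signs Z)] <=
  (ising_law (clique_mx S theta) A)%:E +
  (Num.sqrt (expR (n%:R * ((2 * dist_const + dist_const ^+ 2) * b ^+ 4)) - 1))%:E)%E.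
Proof.
move=> S0 sb thetaE; rewrite gauss_law_signs -EFinD lee_fin.
have -> : ising_law (clique_mx S theta) A =
    \sum_(X in A) \prod_(i < n) curie_weiss S theta (tnth X i).
  by rewrite /ising_law ising_pmf_clique.
apply: le_trans (sum_tuple_le_chi_square A (curie_weiss_gt0 S theta)
  (sum_curie_weiss S theta) (sum_sign_pmf S b)) _.
rewrite lerD2l; set C := (2 * dist_const + dist_const ^+ 2) * b ^+ 4.
have D0 : 0 <= dist_const :> R := dist_const_ge0.
have C0 : 0 <= C by rewrite mulr_ge0 ?exprn_even_ge0// addr_ge0 ?sqr_ge0// mulr_ge0.
have E1 : 1 <= expR (n%:R * C) by rewrite -expR0 ler_expR mulr_ge0.
rewrite ler_sqrt ?subr_ge0// lerD2r; apply: le_trans (exprn_1D_le n C0).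
apply: lerXn2r; rewrite ?nnegrE ?addr_ge0//; last exact: chi_square_sign_pmf.
by apply: sumr_ge0 => x _; rewrite divr_ge0 ?sqr_ge0// ltW// curie_weiss_gt0.
Qed.

End clique_ising.

(** * Reduction *)

Section limits.
Context {R : realType}.
Local Open Scope classical_set_scope.

Lemma limn_einf_le_near (u v : (\bar R)^nat) :
  (\forall n \near \oo, (u n <= v n)%E) -> (limn_einf u <= limn_einf v)%E.
Proof.
move=> uv; rewrite !limn_einf_lim.
apply: lee_lim; [exact: is_cvg_einfs|exact: is_cvg_einfs|].
case: uv => N _ uv; exists N => // m /= Nm.
apply: le_ereal_inf_tmp => /= _ [k /= mk] <-.
apply: le_trans (uv k (leq_trans Nm mk)).
by apply: ereal_inf_lbound; exists k.
Qed.

Lemma limn_einf_ge_perturb (u v : (\bar R)^nat) (l : R) :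
  (forall e : R, 0 < e -> \forall n \near \oo, (u n <= v n + e%:E)%E) ->
  (l%:E <= limn_einf u)%E -> (l%:E <= limn_einf v)%E.
Proof.
move=> uv lu; apply/lee_addgt0Pr => e e0; apply: le_trans lu _.
rewrite addeC -limn_einf_shift//; apply: limn_einf_le_near.
by near=> n; rewrite addeC; near: n; exact: uv.
Unshelve. all: by end_near. Qed.

Lemma near_powR_le (r t : R) : 0 < r -> 0 < t ->
  \forall n \near \oo, (n%:R : R) `^ (- r) <= t.
Proof.
move=> r0 t0; pose q := t `^ (- r^-1).
have q0 : 0 < q by rewrite powR_gt0.
near=> n.
have qn : q <= n%:R by near: n; exact: nbhs_infty_ger.
have n0 : 0 < n%:R :> R := lt_le_trans q0 qn.
rewrite powRN -[leRHS]invrK lef_pV2 ?posrE ?invr_gt0 ?powR_gt0//.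
have -> : t^-1 = q `^ r by rewrite /q -powRrM mulNr mulVf ?lt0r_neq0// powR_inv1// ltW.
by apply: ge0_ler_powR => //; rewrite ?nnegrE ltW.
Unshelve. all: by end_near. Qed.

End limits.

(** * From the signal bound to the comparison of risks *)

Section signal.
Context {R : realType}.
Implicit Types (delta eta theta : R).

(** The s-part of the minimum keeps s theta in the range where the one-sample comparison is
    valid. *)
Lemma sparsity_signal_le delta eta theta n s : 0 < delta -> 0 <= eta -> (0 < s)%N ->
  theta <= eta * signal_bound delta n s -> s%:R * theta <= eta.
Proof.
move=> d0 e0 s0 tb; have s0' : 0 < s%:R :> R by rewrite ltr0n.
rewrite -ler_pdivlMl// mulrC; apply: le_trans tb _.
rewrite ler_wpM2l// /signal_bound ge_min; apply/orP; right.
rewrite -(powR_inv1 (ltW s0')) ler_powR ?ler1n//; lra.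
Qed.

(** The n-part of the minimum makes the divergence of n samples vanish: n times n^(-(1 + 2 delta))
    is n^(-2 delta). *)
Lemma sample_signal_le delta eta theta n s : 0 <= eta <= 1 -> (0 < n)%N -> 0 <= theta ->
  theta <= eta * signal_bound delta n s ->
  n%:R * theta ^+ 2 <= n%:R `^ (- (2 * delta)).
Proof.
move=> /andP[e0 e1] n0 t0 tb; have n0' : 0 < n%:R :> R by rewrite ltr0n.
set w := n%:R `^ (- (1 / 2 + delta)) : R.
have tw : theta <= w.
  apply: le_trans tb _; apply: (@le_trans _ _ (signal_bound delta n s)).
    by rewrite ler_piMl// le_min !powR_ge0.
  by rewrite /signal_bound ge_min lexx.
have -> : n%:R `^ (- (2 * delta)) = n%:R * w ^+ 2 :> R.
  rewrite expr2 -powRD ?lt0r_neq0 ?implybT// -[X in _ = X * _]powRr1 ?(ltW n0')//.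
  by rewrite -powRD ?lt0r_neq0 ?implybT//; congr (_ `^ _); lra.
by rewrite ler_pM2l//; apply: lerXn2r; rewrite ?nnegrE// (le_trans t0).
Qed.

(** The null terms are equal, and each covariance with support S is matched with the clique matrix
    on S. The formula for b^2 solves theta = b^2 / (2 (1 + s b^2)). *)
Lemma sparse_pca_risk_le_ising (d s n : nat) (b theta : R) (G : rel 'I_d)
    (psi : n.-tuple (d.-tuple bool) -> bool) :
  (0 < s)%N -> clique_graph s G -> 0 < theta -> s%:R * theta <= 64^-1 ->
  b ^+ 2 = 2 * theta / (1 - 2 * (s%:R * theta)) ->
  (sparse_pca_risk s ((b / sign_slope) ^+ 2) (fun Z => psi (signs Z)) <=
   ising_risk (graphs_containing G) theta psi +
   (Num.sqrt (expR (n%:R * ((2 * dist_const + dist_const ^+ 2) * b ^+ 4)) - 1))%:E)%E.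
Proof.
move=> s0 cG t0 st bE; rewrite /sparse_pca_risk /ising_risk -addeA; apply: leeD.
  by rewrite ising_law0.
have st0 : 0 <= s%:R * theta by rewrite mulr_ge0// ltW.
set T := 1 - 2 * (s%:R * theta) in bE.
have T1 : 31 / 32 <= T by rewrite /T; lra.
have TV : T * T^-1 = 1 by rewrite mulfV// lt0r_neq0//; lra.
(* With s theta <= 1/64 one has T >= 31/32, so s b^2 = 1/T - 1 <= 1/16. *)
have sbT : 1 + s%:R * b ^+ 2 = T^-1.
  rewrite bE (_ : s%:R * (2 * theta / T) = (1 - T) * T^-1); last by rewrite /T; lra.
  by rewrite mulrBl TV; lra.
have T2 : T^-1 <= 17 / 16.
  by rewrite -(ler_pM2l (_ : 0 < T)) ?TV; lra.
apply: ge_ereal_sup => _ [Sigma /spiked_covP[S Ss ->] <-].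
have sb : #|S|%:R * b ^+ 2 <= 16^-1 by rewrite Ss; lra.
have thetaE : theta = b ^+ 2 / (2 * (1 + #|S|%:R * b ^+ 2)).
  rewrite Ss sbT invfM invrK bE.
  rewrite (_ : _ * _ = theta * (T * T^-1)); last by lra.
  by rewrite TV mulr1.
have := @gauss_law_le_ising _ _ S b theta n [pred X | ~~ psi X] _ sb thetaE.
rewrite {1}Ss => /(_ s0) le1; apply: le_trans le1 _.
rewrite leeD2r//; apply: ereal_sup_ubound; exists (clique_mx S theta) => //.
by apply: clique_mx_class; rewrite // Ss//; lra.
Qed.

End signal.

Theorem theorem4p2 (R : realType) (d s : nat -> nat)
    (s_bounds : forall n, (0 < s n <= d n)%N)
    (hardness : sparse_pca_conjecture R d s)
    (delta : R) (delta_gt0 : 0 < delta) :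
  exists2 eta : R, 0 < eta &
    forall theta : nat -> R,
      (forall n, (0 < n)%N ->
         0 < theta n <= eta * signal_bound delta n (s n)) ->
    forall psi : (forall n, n.-tuple ((d n).-tuple bool) -> bool),
      poly_time_test (@spin R) s psi ->
    forall Gstar : (forall n, rel 'I_(d n)),
      (forall n, clique_graph (s n) (Gstar n)) ->
      ((1 / 4)%:E <=
        limn_einf (fun n =>
          ising_risk (graphs_containing (Gstar n)) (theta n) (psi n)))%E.
Proof.
have [eta0 eta0_gt0 hard] := hardness delta delta_gt0.
set c : R := sign_slope; have c_gt0 : 0 < c := sign_slope_gt0.
have c2_gt0 : 0 < c ^+ 2 by rewrite exprn_gt0.
(* The first bound gives s theta <= 1/64. The second serves the spike strength b^2 / c^2 <= 4 theta
   / c^2, which must be at most eta0 times the signal bound. *)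
pose eta := Num.min (64^-1) (eta0 * c ^+ 2 / 4).
have eta_gt0 : 0 < eta by rewrite lt_min invr_gt0 ltr0n /= divr_gt0// mulr_gt0.
have eta_le : eta <= 64^-1 by rewrite ge_min lexx.
have eta_le0 : eta <= eta0 * c ^+ 2 / 4 by rewrite ge_min lexx orbT.
exists eta => // theta theta_bound psi psi_poly Gstar cliqueG.
pose bb n := 2 * theta n / (1 - 2 * ((s n)%:R * theta n)).
pose b n := Num.sqrt (bb n).
have s_gt0 n : (0 < s n)%N by case/andP: (s_bounds n).
have theta_gt0 n : (0 < n)%N -> 0 < theta n by move=> /theta_bound/andP[].
have s_theta n : (0 < n)%N -> (s n)%:R * theta n <= 64^-1.
  move=> n0; apply: le_trans eta_le; have /andP[_] := theta_bound n n0.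
  exact: sparsity_signal_le (ltW eta_gt0) (s_gt0 n).
have bb_bounds n : (0 < n)%N -> 0 < bb n <= 4 * theta n.
  move=> n0; have t0 := theta_gt0 n n0; have st := s_theta n n0.
  have T0 : 0 < 1 - 2 * ((s n)%:R * theta n) by lra.
  rewrite divr_gt0 ?mulr_gt0//= ler_pdivrMr//.
  rewrite -subr_ge0 (_ : _ - _ = 2 * theta n * (1 - 4 * ((s n)%:R * theta n))); last by lra.
  by rewrite !mulr_ge0//; lra.
have b2 n : (0 < n)%N -> b n ^+ 2 = bb n.
  by move=> n0; rewrite sqr_sqrtr//; case/andP: (bb_bounds n n0) => /ltW.
pose sigma n := (b n / c) ^+ 2.
have sigma_bound n : (0 < n)%N -> 0 < sigma n <= eta0 * signal_bound delta n (s n).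
  move=> n0; have /andP[bb0 bb4] := bb_bounds n n0.
  rewrite /sigma exprMn exprVn b2// divr_gt0//= ler_pdivrMr//.
  have /andP[_ tb] := theta_bound n n0.
  have B0 : 0 <= signal_bound delta n (s n) by rewrite le_min !powR_ge0.
  apply: le_trans bb4 _; have := ler_wpM2r B0 eta_le0; move: tb.
  by set B := signal_bound _ _ _; lra.
have psi'_poly := poly_time_test_signs (fun n =>
  leq_trans (s_gt0 n) (proj2 (andP (s_bounds n)))) psi_poly.
have := hard sigma sigma_bound _ psi'_poly.
apply: limn_einf_ge_perturb => e e0.
set D := 2 * dist_const + dist_const ^+ 2 : R.
have D0 : 0 <= D by rewrite addr_ge0 ?sqr_ge0// mulr_ge0// dist_const_ge0.
(* Chosen so that n theta^2 <= t and b^4 <= 16 theta^2 give exp (n D b^4) - 1 <= e^2. Using D + 1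
   keeps the denominator positive. *)
pose t := ln (1 + e ^+ 2) / (16 * (D + 1)).
have e20 : 0 < e ^+ 2 by rewrite exprn_gt0.
have t0 : 0 < t.
  by rewrite divr_gt0 ?ln_gt0 ?mulr_gt0//; lra.
near=> n.
have n0 : (0 < n)%N by near: n; exact: nbhs_infty_gt.
have nt : n%:R `^ (- (2 * delta)) <= t.
  by near: n; apply: near_powR_le => //; rewrite mulr_gt0.
apply: le_trans (sparse_pca_risk_le_ising _ (s_gt0 n) (cliqueG n) (theta_gt0 n n0)
  (s_theta n n0) (b2 n n0)) _.
rewrite leeD2l// lee_fin -[leRHS](ger0_norm (ltW e0)) -sqrtr_sqr ler_sqrt ?sqr_ge0//.
rewrite lerBlDl -[leRHS]lnK ?posrE ?addr_gt0// ler_expR.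
have /andP[/ltW bb0 bb4] := bb_bounds n n0.
have t0n := theta_gt0 n n0; have /andP[_ tb] := theta_bound n n0.
have nth : n%:R * theta n ^+ 2 <= t.
  apply: le_trans nt; apply: sample_signal_le tb => //; last exact: ltW.
  by rewrite ltW//=; lra.
have b4 : b n ^+ 4 <= 16 * theta n ^+ 2.
  rewrite (exprM _ 2 2) b2// (_ : 16 * _ = (4 * theta n) ^+ 2); last by lra.
  by apply: lerXn2r; rewrite ?nnegrE// (le_trans bb0).
apply: (@le_trans _ _ ((16 * (D + 1)) * (n%:R * theta n ^+ 2))).
  rewrite (_ : 16 * (D + 1) * _ = n%:R * ((D + 1) * (16 * theta n ^+ 2))); last by lra.
  rewrite ler_wpM2l//; apply: ler_pM => //; first by rewrite exprn_even_ge0.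
  by rewrite lerDl.
have -> : ln (1 + e ^+ 2) = 16 * (D + 1) * t.
  by rewrite /t mulrC divfK// lt0r_neq0// mulr_gt0//; lra.
by rewrite ler_wpM2l// mulr_ge0//; lra.
Unshelve. all: by end_near. Qed.
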